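(* Let $\Gamma$ be a finite connected simplicial graph, and assume that $\Gamma_0$ has at least two vertices (that is, $\Gamma$ has at least two maximal equivalence classes of vertices). Let $K$ be the kernel of the restriction homomorphism $R=\prod R_{[v]}: Out^0(A_\Gamma)\to\prod Out(A_{J_{[v]}})$ and let $K_P$ be the kernel of the projection homomorphism $P=\prod P_{[v]}: Out^0(A_\Gamma)\to\prod Out(A_{L_{[v]}})$, both products being over all maximal equivalence classes $[v]$. Then $K_P$ is a free abelian group generated by $K$ and the set of (classes in $Out^0(A_\Gamma)$ of) leaf transvections.
   Context: $A_\Gamma$ is the right-angled Artin group of $\Gamma$: generators are the vertices, relations are $vw=wv$ for adjacent $v,w$. For a subgraph (or set of vertices) $\Theta$, $A_\Theta\le A_\Gamma$ denotes the subgroup generated by the vertices of $\Theta$. The link $lk(v)$ is the subgraph spanned by vertices at distance one from $v$, and the star $st(v)$ is the subgraph spanned by vertices at distance at most one. For vertices $v,w$ set $v\le w$ if $lk(v)\subseteq st(w)$; this relation is transitive. Write $v\sim w$ if $v\le w$ and $w\le v$; this is an equivalence relation, $[v]$ is the class of $v$, and $\le$ induces a partial order on classes; ''maximal'' refers to this partial order. $[v]<[w]$ means $[v]\le[w]$ and $[v]\ne[w]$. Put $L_{[v]}=lk(v)\setminus[v]$ and $J_{[v]}=L_{[v]}\ast[v]$ (the subgraph spanned by $L_{[v]}\cup[v]$; every vertex of $L_{[v]}$ is adjacent to every vertex of $[v]$), so $A_{J_{[v]}}=A_{L_{[v]}}\times A_{[v]}$. $\Gamma_0$ is the graph whose vertices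 are the maximal classes, with $[v],[w]$ joined by an edge iff $v,w$ are adjacent in $\Gamma$ and $[v]\neq[w]$. The pure automorphism group $Aut^0(A_\Gamma)\le Aut(A_\Gamma)$ is the subgroup generated by: inner automorphisms; inversions (sending one vertex generator to its inverse and fixing the others); transvections $v\mapsto vw$ for distinct vertices with $v\le w$ (fixing the other generators); and partial conjugations (for a vertex $v$ such that $\Gamma-st(v)$ is disconnected, conjugating by $v$ all the generators in one component of $\Gamma-st(v)$ and fixing the other generators). $Out^0(A_\Gamma)$ is the image of $Aut^0(A_\Gamma)$ in $Out(A_\Gamma)$. For each maximal class $[v]$, every $\phi\in Out^0(A_\Gamma)$ has a representative $\phi_v\in Aut^0(A_\Gamma)$ preserving both $A_{[v]}$ and $A_{J_{[v]}}$; the restriction of $\phi_v$ to $A_{J_{[v]}}$ defines a homomorphism $R_{[v]}:Out^0(A_\Gamma)\to Out(A_{J_{[v]}})$, and the automorphism induced by $\phi_v$ on $A_{J_{[v]}}/A_{[v]}\cong A_{L_{[v]}}$ defines a homomorphism $P_{[v]}:Out^0(A_\Gamma)\to Out(A_{L_{[v]}})$; both are well defined. A vertex $v$ is leaf-like if $L_{[v]}$ contains a unique maximal class $[w]$ (i.e. a unique class that is maximal in the partial order on the classes of $\Gamma$), and moreover $[v]<[w]$. In that case, for each $w$ in this class, the transvection $t(v,w): v\mapsto vw$ (fixing all other vertex generators) is called a leaf transvection. *)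

(* Defs.v *)
From HB Require Import structures.
From mathcomp Require Import all_boot ssralg ssrint.
From mathcomp Require Import boolp classical_sets.
From mathcomp Require Import freeg.

Set Implicit Arguments.
Unset Strict Implicit.
Unset Printing Implicit Defensive.

Local Open Scope quotient_scope.
Local Open Scope classical_set_scope.
Local Open Scope group_scope.

Section Subgroups.
Variable G : groupType.
Implicit Types (H X : set G) (x y : G).

Definition is_subgroup H : Prop := group_closed [in H].

Definition generated X : set G := smallest is_subgroup X.

Lemma generated_subgroup X : is_subgroup (generated X).
Proof.
split; first by rewrite inE => H [[/set_mem H1 _] _].
move=> x y /set_mem Xx /set_mem Xy; rewrite inE => H HX.
have [[_ HF] _] := HX.
by apply: set_mem; apply: HF; rewrite inE; [apply: Xx|apply: Xy].
Qed.

Definition gen_pred X : {pred G} := [in generated X].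

(* The subgroup generated by X, as a group in its own right. *)
Record subgroup_of X := MkSub { sub_val : G; _ : gen_pred X sub_val }.

HB.instance Definition _ X := [isSub for @sub_val X].
HB.instance Definition _ X := [Choice of subgroup_of X by <:].
HB.instance Definition _ X := SubChoice_isSubGroup.Build G (gen_pred X)
  (subgroup_of X) (generated_subgroup X).

(* H is isomorphic to the free abelian group (written additively in the       *)
(* library) on some, possibly infinite, set of generators.                    *)
Definition free_abelian H : Prop :=
  exists (I : choiceType) (f : {freeg I / int} -> G),
    [/\ forall a b, f (a + b)%R = f a * f b, injective f & range f = H].

End Subgroups.

Section Automorphisms.
Variable G : groupType.

(* The inverse is a field only so that it need not be chosen; it is           *)
(* determined by the underlying function, see aut_eqP.                        *)
Record Aut := MkAut {
  aut_fun :> G -> G;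
  aut_inv : G -> G;
  aut_funK : cancel aut_fun aut_inv;
  aut_invK : cancel aut_inv aut_fun;
  aut_morph : {morph aut_fun : x y / x * y} }.

HB.instance Definition _ := gen_eqMixin Aut.
HB.instance Definition _ := gen_choiceMixin Aut.

Lemma aut_eqP (f g : Aut) : f =1 g -> f = g.
Proof.
case: f g => [f f' fK f'K fM] [g g' gK g'K gM] /= /funext fg.
move: fg gK g'K gM => <- gK g'K gM.
have : f' = g' by apply/funext => x; rewrite -[in LHS](g'K x) fK.
move=> e; move: e gK g'K => <- gK g'K.
by congr MkAut; exact: Prop_irrelevance.
Qed.

Definition aut_one : Aut :=
  @MkAut id id (fun=> erefl) (fun=> erefl) (fun _ _ => erefl).

Lemma aut_comp_morph (f g : Aut) : {morph (f \o g) : x y / x * y}.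
Proof. by move=> x y; rewrite /= !aut_morph. Qed.

Definition aut_mul (f g : Aut) : Aut :=
  MkAut (can_comp (aut_funK f) (aut_funK g))
        (can_comp (aut_invK g) (aut_invK f)) (aut_comp_morph f g).

Lemma aut_inv_morph (f : Aut) : {morph aut_inv f : x y / x * y}.
Proof.
by move=> x y; rewrite -{1}(aut_invK f x) -{1}(aut_invK f y) -aut_morph aut_funK.
Qed.

Definition aut_V (f : Aut) : Aut :=
  MkAut (aut_invK f) (aut_funK f) (@aut_inv_morph f).

Lemma aut_mulA : associative aut_mul.
Proof. by move=> f g h; apply: aut_eqP. Qed.
Lemma aut_mul1 : left_id aut_one aut_mul.
Proof. by move=> f; apply: aut_eqP. Qed.
Lemma aut_mulr1 : right_id aut_one aut_mul.
Proof. by move=> f; apply: aut_eqP. Qed.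
Lemma aut_mulV : left_inverse aut_one aut_V aut_mul.
Proof. by move=> f; apply: aut_eqP => x /=; rewrite aut_funK. Qed.
Lemma aut_mulrV : right_inverse aut_one aut_V aut_mul.
Proof. by move=> f; apply: aut_eqP => x /=; rewrite aut_invK. Qed.

HB.instance Definition _ :=
  isGroup.Build Aut aut_mulA aut_mul1 aut_mulr1 aut_mulV aut_mulrV.

Definition is_inner (f : Aut) : Prop := exists g : G, forall x, f x = x ^ g.

Definition out_rel (f g : Aut) : bool := `[< is_inner (f / g) >].

Lemma is_innerP (f g : Aut) :
  is_inner (f / g) <-> exists a : G, forall x, f x = g x ^ a.
Proof.
split=> [[a fg]|[a fg]]; exists a => x.
  by rewrite -fg /= aut_funK.
by rewrite [LHS]fg aut_invK.
Qed.

Lemma out_rel_refl : reflexive out_rel.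
Proof.
by move=> f; apply/asboolP/is_innerP; exists 1 => x; rewrite conjg1.
Qed.
Lemma out_rel_sym : symmetric out_rel.
Proof.
suff h f g : out_rel f g -> out_rel g f by move=> f g; apply/idP/idP; apply: h.
move=> /asboolP/is_innerP[a fg]; apply/asboolP/is_innerP; exists a^-1 => x.
by rewrite fg conjgK.
Qed.
Lemma out_rel_trans : transitive out_rel.
Proof.
move=> g f h /asboolP/is_innerP[a fg] /asboolP/is_innerP[b gh].
by apply/asboolP/is_innerP; exists (b * a) => x; rewrite fg gh conjgM.
Qed.

Canonical out_equiv := EquivRel out_rel out_rel_refl out_rel_sym out_rel_trans.

Definition Out := {eq_quot out_rel}.
HB.instance Definition _ := Choice.on Out.
HB.instance Definition _ := EqQuotient.on Out.

Definition out_class (f : Aut) : Out := \pi_Out f.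

Lemma out_classP (f g : Aut) :
  out_class f = out_class g <-> exists a : G, forall x, f x = g x ^ a.
Proof.
split=> [/eqmodP/asboolP/is_innerP //|h]; apply/eqmodP/asboolP.
exact/is_innerP.
Qed.

Definition out_mul (p q : Out) : Out := out_class (repr p * repr q).
Definition out_inv (p : Out) : Out := out_class (repr p)^-1.

Lemma out_reprK (p : Out) : out_class (repr p) = p.
Proof. exact: reprK. Qed.

Lemma out_repr (f : Aut) : exists a : G, forall x, repr (out_class f) x = f x ^ a.
Proof. by apply/out_classP; rewrite out_reprK. Qed.

Lemma out_classM (f g : Aut) : out_mul (out_class f) (out_class g) = out_class (f * g).
Proof.
apply/out_classP; have [a fa] := out_repr f; have [b gb] := out_repr g.
exists (f b * a) => x /=.
by rewrite fa gb /conjg !aut_morph -/(conjg _ _) -/(conjg _ _) conjgM /conjg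
  -[f b^-1](mulgK (f b)) -aut_morph mulVg -(mulgK (f 1) (f 1)) -aut_morph
  mulg1 mulgV mul1g.
Qed.

Lemma out_mulA : associative out_mul.
Proof.
move=> p q r; rewrite -[p]out_reprK -[q]out_reprK -[r]out_reprK.
by rewrite !out_classM mulgA.
Qed.
Lemma out_mul1 : left_id (out_class 1) out_mul.
Proof. by move=> p; rewrite -[p]out_reprK out_classM mul1g. Qed.
Lemma out_mulr1 : right_id (out_class 1) out_mul.
Proof. by move=> p; rewrite -[p]out_reprK out_classM mulg1. Qed.
Lemma out_mulV : left_inverse (out_class 1) out_inv out_mul.
Proof. by move=> p; rewrite -{2}[p]out_reprK out_classM mulVg. Qed.
Lemma out_mulrV : right_inverse (out_class 1) out_inv out_mul.
Proof. by move=> p; rewrite -{1}[p]out_reprK out_classM mulgV. Qed.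

HB.instance Definition _ :=
  isGroup.Build Out out_mulA out_mul1 out_mulr1 out_mulV out_mulrV.

Definition preserves (f : Aut) (H : set G) : Prop := [set f x | x in H] = H.

End Automorphisms.

Record sgraph := MkGraph {
  vertex :> finType;
  adj : rel vertex;
  adj_sym : symmetric adj;
  adj_irr : irreflexive adj }.

Section Graphs.
Variable Gamma : sgraph.
Implicit Types (v w x y : Gamma) (C : {set Gamma}).

Definition graph_connected : Prop := forall x y, connect (@adj Gamma) x y.

Definition lk v : {set Gamma} := [set w | adj v w]%SET.
Definition st v : {set Gamma} := (v |: lk v)%SET.

Definition vle v w : bool := lk v \subset st w.
Definition veq v w : bool := vle v w && vle w v.
Definition cls v : {set Gamma} := [set w | veq v w]%SET.
Definition cls_lt v w : bool := vle v w && (cls v != cls w).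

Definition maximal v : bool := [forall w, vle v w ==> (cls w == cls v)].

Definition Gamma0_vertices : {set {set Gamma}} := [set cls v | v in maximal]%SET.

Definition L v : {set Gamma} := (lk v :\: cls v)%SET.
Definition J v : {set Gamma} := (L v :|: cls v)%SET.

Definition adj_off_st v : rel Gamma :=
  [rel x y | [&& x \notin st v, y \notin st v & adj x y]].

Definition components_off_st v : {set {set Gamma}} :=
  [set [set y | connect (adj_off_st v) x y]%SET | x in ~: st v]%SET.

(* L_[v] contains the class [w] as its only maximal class, and [v] < [w]. *)
Definition leaf_like_via v w : Prop :=
  [/\ maximal w, cls w \subset L v,
      (forall u, maximal u -> cls u \subset L v -> cls u = cls w) & cls_lt v w].

(* Words in the letters v, v^-1: the letter (v, true) stands for the         *)
(* generator v and (v, false) for its inverse.                               *)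
Definition word := seq (Gamma * bool).

Inductive word_eq : word -> word -> Prop :=
| word_refl s : word_eq s s
| word_sym s t : word_eq s t -> word_eq t s
| word_trans s t u : word_eq s t -> word_eq t u -> word_eq s u
| word_cancel s t v b : word_eq (s ++ [:: (v, b); (v, ~~ b)] ++ t) (s ++ t)
| word_comm s t v w b c : adj v w ->
    word_eq (s ++ [:: (v, b); (w, c)] ++ t) (s ++ [:: (w, c); (v, b)] ++ t).

Definition word_rel (s t : word) : bool := `[< word_eq s t >].

Lemma word_rel_refl : reflexive word_rel.
Proof. by move=> s; apply/asboolP; constructor. Qed.
Lemma word_rel_sym : symmetric word_rel.
Proof. by move=> s t; apply/asboolP/asboolP; apply: word_sym. Qed.
Lemma word_rel_trans : transitive word_rel.
Proof.
by move=> t s u /asboolP st /asboolP tu; apply/asboolP; apply: word_trans tu.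
Qed.

Canonical word_equiv :=
  EquivRel word_rel word_rel_refl word_rel_sym word_rel_trans.

Definition raag := {eq_quot word_rel}.
HB.instance Definition _ := Choice.on raag.
HB.instance Definition _ := EqQuotient.on raag.

Definition word_class (s : word) : raag := \pi_raag s.

Lemma word_classP s t : word_class s = word_class t <-> word_eq s t.
Proof. by split=> [/eqmodP/asboolP //|h]; apply/eqmodP/asboolP. Qed.

Definition word_inv (s : word) : word := rev [seq (l.1, ~~ l.2) | l <- s].

Lemma word_eq_catl r s t : word_eq s t -> word_eq (r ++ s) (r ++ t).
Proof.
elim=> {s t} [s|s t _|s t u _ st _|s t v b|s t v w b c vw].
- exact: word_refl.
- exact: word_sym.
- exact: word_trans.
- by rewrite !(catA r); apply: word_cancel.
- by rewrite !(catA r); apply: word_comm.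
Qed.

Lemma word_eq_catr r s t : word_eq s t -> word_eq (s ++ r) (t ++ r).
Proof.
elim=> {s t} [s|s t _|s t u _ st _|s t v b|s t v w b c vw].
- exact: word_refl.
- exact: word_sym.
- exact: word_trans.
- by rewrite -!catA; apply: word_cancel.
- by rewrite -!catA; apply: word_comm.
Qed.

Lemma word_eq_inv s t : word_eq s t -> word_eq (word_inv s) (word_inv t).
Proof.
elim=> {s t} [s|s t _|s t u _ st _|s t v b|s t v w b c vw].
- exact: word_refl.
- exact: word_sym.
- exact: word_trans.
- rewrite /word_inv !map_cat !rev_cat -catA /= negbK.
  exact: (word_cancel _ _ v b).
- rewrite /word_inv !map_cat !rev_cat -!catA.
  by apply: word_comm; rewrite adj_sym.
Qed.

Lemma word_eq_mulV s : word_eq (s ++ word_inv s) [::].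
Proof.
elim/last_ind: s => [|s [v b] IH]; first exact: word_refl.
rewrite /word_inv map_rcons rev_rcons -cats1 -catA.
exact: word_trans (word_cancel _ _ v b) IH.
Qed.

Lemma word_invK : involutive word_inv.
Proof.
move=> s; rewrite /word_inv map_rev revK -map_comp -[RHS]map_id.
by apply: eq_map => -[v b] /=; rewrite negbK.
Qed.

Definition raag_mul (p q : raag) : raag := word_class (repr p ++ repr q).
Definition raag_inv (p : raag) : raag := word_class (word_inv (repr p)).

Lemma raag_reprK (p : raag) : word_class (repr p) = p.
Proof. exact: reprK. Qed.

Lemma word_repr s : word_eq (repr (word_class s)) s.
Proof. by apply/word_classP; rewrite raag_reprK. Qed.

Lemma raag_classM s t :
  raag_mul (word_class s) (word_class t) = word_class (s ++ t).
Proof.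
apply/word_classP; apply: word_trans (word_eq_catl _ (word_repr t)).
exact: word_eq_catr (word_repr s).
Qed.

Lemma raag_mulA : associative raag_mul.
Proof.
move=> p q r; rewrite -[p]raag_reprK -[q]raag_reprK -[r]raag_reprK.
by rewrite !raag_classM catA.
Qed.
Lemma raag_mul1 : left_id (word_class [::]) raag_mul.
Proof. by move=> p; rewrite -[p]raag_reprK raag_classM. Qed.
Lemma raag_mulr1 : right_id (word_class [::]) raag_mul.
Proof. by move=> p; rewrite -[p]raag_reprK raag_classM cats0. Qed.
Lemma raag_mulV : left_inverse (word_class [::]) raag_inv raag_mul.
Proof.
move=> p; rewrite -{2}[p]raag_reprK raag_classM; apply/word_classP.
by rewrite -{2}[repr p]word_invK; apply: word_eq_mulV.
Qed.
Lemma raag_mulrV : right_inverse (word_class [::]) raag_inv raag_mul.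
Proof.
move=> p; rewrite -{1}[p]raag_reprK raag_classM; apply/word_classP.
exact: word_eq_mulV.
Qed.

HB.instance Definition _ :=
  isGroup.Build raag raag_mulA raag_mul1 raag_mulr1 raag_mulV raag_mulrV.

Definition vgen v : raag := word_class [:: (v, true)].

(* A_Theta, as a subset of A_Gamma and as a group. *)
Definition special (Theta : {set Gamma}) : set raag :=
  generated [set vgen v | v in [set` Theta]].
Definition raag_on (Theta : {set Gamma}) : groupType :=
  subgroup_of [set vgen v | v in [set` Theta]].

Definition is_inversion (f : Aut raag) : Prop :=
  exists v, f (vgen v) = (vgen v)^-1 /\ forall u, u != v -> f (vgen u) = vgen u.

Definition is_transvection v w (f : Aut raag) : Prop :=
  [/\ v != w, vle v w, f (vgen v) = vgen v * vgen w
    & forall u, u != v -> f (vgen u) = vgen u].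

(* Conjugation is u ^ v = v^-1 u v in the library; the opposite convention    *)
(* gives the inverse automorphisms, hence the same Aut0.                      *)
Definition is_partial_conjugation (f : Aut raag) : Prop :=
  exists v C, [/\ (1 < #|components_off_st v|)%N, C \in components_off_st v,
    (forall u, u \in C -> f (vgen u) = vgen u ^ vgen v)
    & forall u, u \notin C -> f (vgen u) = vgen u].

Definition Aut0 : set (Aut raag) :=
  generated [set f | [\/ is_inner f, is_inversion f,
    (exists v w, is_transvection v w f) | is_partial_conjugation f]].

Definition Out0 : set (Out raag) := [set out_class f | f in Aut0].

Definition good_rep v (phi : Out raag) (f : Aut raag) : Prop :=
  [/\ Aut0 f, out_class f = phi, preserves f (special (cls v))
    & preserves f (special (J v))].

(* R_[v] phi = psi if psi is the class of the restriction to A_J[v] of a      *)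
(* representative of phi preserving A_[v] and A_J[v].                         *)
Definition R_graph v (phi : Out raag) (psi : Out (raag_on (J v))) : Prop :=
  exists f g, [/\ good_rep v phi f, out_class g = psi
    & forall x : raag_on (J v), \val (g x) = f (\val x)].

(* Under A_J[v] / A_[v] = A_L[v] (y in A_L[v] corresponding to the coset      *)
(* y A_[v]), the automorphism of the quotient induced by f is the g such that *)
(* g x A_[v] = f x A_[v] for all x in A_L[v].                                 *)
Definition P_graph v (phi : Out raag) (psi : Out (raag_on (L v))) : Prop :=
  exists f g, [/\ good_rep v phi f, out_class g = psi
    & forall x : raag_on (L v), special (cls v) ((\val (g x))^-1 * f (\val x))].

(* For [v] maximal and phi in Out0, there is exactly one such psi; the value  *)
(* 1 where there is none is junk.                                             *)
Definition R v : Out raag -> Out (raag_on (J v)) :=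
  fun_of_rel (fun=> 1) (@R_graph v).
Definition P v : Out raag -> Out (raag_on (L v)) :=
  fun_of_rel (fun=> 1) (@P_graph v).

(* The kernel of the product of the R_[v] is the intersection of the kernels; *)
(* [v] ranges over the maximal classes through their representatives.         *)
Definition K : set (Out raag) :=
  [set phi | Out0 phi /\ forall v, maximal v -> R v phi = 1].
Definition K_P : set (Out raag) :=
  [set phi | Out0 phi /\ forall v, maximal v -> P v phi = 1].

Definition leaf_transvections : set (Out raag) :=
  [set phi | exists v w f,
    [/\ leaf_like_via v w, is_transvection v w f & out_class f = phi]].

End Graphs.

Arguments Aut0 : clear implicits.
Arguments Out0 : clear implicits.
Arguments K : clear implicits.
Arguments K_P : clear implicits.
Arguments leaf_transvections : clear implicits.

(* Main.v *)
(* Let [v], [w] be adjacent maximal classes and phi in K_P. Representatives of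
   phi adapted to [v] and to [w] can be normalized so that the first one is the
   identity on A_[v] and multiplies each leaf-like vertex of L_[v] attached to
   [v] by a central element of A_[v], fixing the rest of L_[v]. The two then
   differ by conjugation by an element centralizing the intersection of J_[v]
   and J_[w]; this centralizer is free abelian on vertices central in that
   intersection, none of them leaf-like. Since Gamma_0 is connected, a
   representative f of phi sends each vertex x to a conjugate (x a)^h, and phi
   is determined by the exponent sums of a and, for u not in st(x), by those of
   u in h up to a constant depending on u only. The exponent of u in h is the
   Magnus coefficient of x u in f(x). These integers are additive on K_P and
   embed it into some Z^N; the exponents of a are cleared by leaf
   transvections, after which phi lies in K. *)

Require Import Defs.
From HB Require Import structures.
From mathcomp Require Import all_boot ssralg ssrnum ssrint order.
From mathcomp Require Import boolp classical_sets.
From mathcomp Require Import freeg matrix zmodp intdiv ring zify.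

Set Implicit Arguments.
Unset Strict Implicit.
Unset Printing Implicit Defensive.

Import Order.TTheory GRing.Theory Num.Theory.

Local Open Scope classical_set_scope.
Local Open Scope group_scope.

Notation "{ 'hom' G -> H }" := (UMagmaMorphism.type G H)
  (at level 0, G at level 98, H at level 99, format "{ 'hom'  G  ->  H }") : type_scope.

(** Commutativity of [K_P] is never checked on elements: an injective additive map to Z^N gives it
    together with freeness, since subgroups of Z^N have bases. The difficulty is to extract integers
    from h, which the equation f(x) = (x a)^h leaves ambiguous: h may change on the left by the
    centralizer of x a, and another choice of f changes all the h on the right by one common factor.
    A Magnus coefficient is read off f(x) itself, so it ignores the first ambiguity; subtracting the
    values at two vertices x, z for the same u removes the second. For a composite f F the
    conjugator is k f(l), so additivity needs f to keep the exponent sums of l. This is why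
    leaf-like vertices must stay out of the conjugators: on each other vertex f acts by some
    conjugation. The second maximal class enters through a neighbour [w] of [v]: the representative
    at [w] forces the one at [v] to restrict to A_[v] as a conjugation. *)

Lemma morph_divg (G H : groupType) (f : G -> H) :
  {morph f : x y / x * y} -> {morph f : x y / x / y}.
Proof.
move=> fM x y; have f1 : f 1 = 1 by apply: (mulgI (f 1)); rewrite -fM !mulg1.
by rewrite fM; congr (_ * _); apply/esym/mulg1_eq; rewrite -fM mulgV.
Qed.

HB.instance Definition _ (G : groupType) (f : Aut G) :=
  isGroupMorphism.Build G G f (morph_divg (@aut_morph G f)).

(** * Subgroups given by predicates *)

Section Subgroups.
Variable G : groupType.
Implicit Types (H X : set G) (x y a b : G).

Lemma is_subgroupP H :
  is_subgroup H <-> H 1 /\ forall x y, H x -> H y -> H (x / y).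
Proof.
split=> [[/set_mem H1 HF]|[H1 HF]]; split.
- by [].
- by move=> x y Hx Hy; apply: set_mem; apply: HF; apply: mem_set.
- exact: mem_set.
- by move=> x y /set_mem Hx /set_mem Hy; apply: mem_set; apply: HF.
Qed.

Lemma is_subgroup1 H : is_subgroup H -> H 1.
Proof. by case/is_subgroupP. Qed.

Lemma is_subgroupF H x y : is_subgroup H -> H x -> H y -> H (x / y).
Proof. by case/is_subgroupP => _; apply. Qed.

Lemma is_subgroupV H x : is_subgroup H -> H x -> H x^-1.
Proof. by move=> sH Hx; rewrite -div1g; apply: is_subgroupF => //; apply: is_subgroup1. Qed.

Lemma is_subgroupM H x y : is_subgroup H -> H x -> H y -> H (x * y).
Proof.
by move=> sH Hx Hy; rewrite -[y]invgK; apply: is_subgroupF => //; apply: is_subgroupV.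
Qed.

Lemma is_subgroupJ H x y : is_subgroup H -> H x -> H y -> H (x ^ y).
Proof.
by move=> sH Hx Hy; apply: is_subgroupM (is_subgroupM _ Hx Hy); rewrite //; apply: is_subgroupV.
Qed.

Lemma generated_sub X H : is_subgroup H -> X `<=` H -> generated X `<=` H.
Proof. exact: smallest_sub. Qed.

Lemma sub_generated X : X `<=` generated X.
Proof. exact: sub_gen_smallest. Qed.

Lemma commute_subgroup x : is_subgroup [set y | commute x y].
Proof.
apply/is_subgroupP; split; first exact: commute1.
by move=> a b xa xb; apply: commuteM => //; apply: commuteV.
Qed.

Lemma commute_conj x y : commute x y -> x ^ y = x.
Proof. by move=> xy; rewrite conjgE xy mulKg. Qed.

Lemma conj_commute x y : x ^ y = x -> commute x y.
Proof. by move=> xy; rewrite /commute conjgC xy. Qed.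

End Subgroups.

Lemma preim_subgroup (G H : groupType) (f : {hom G -> H}) (S : set H) :
  is_subgroup S -> is_subgroup [set x | S (f x)].
Proof.
move=> sS; apply/is_subgroupP; split=> /=; first by rewrite gmulf1; apply: is_subgroup1.
by move=> x y Sx Sy; rewrite /= gmulfF; apply: is_subgroupF.
Qed.

Lemma eq_hom_subgroup (G H : groupType) (f g : {hom G -> H}) :
  is_subgroup [set x | f x = g x].
Proof.
apply/is_subgroupP; split; first by rewrite /= !gmulf1.
by move=> x y /= fgx fgy; rewrite !gmulfF fgx fgy.
Qed.

Lemma one_subgroup (G : groupType) : is_subgroup [set 1 : G].
Proof. by apply/is_subgroupP; split=> // x y -> ->; rewrite /= divg1. Qed.

(** * Universal property and retractions onto special subgroups *)

Section Raag.
Variable Gamma : sgraph.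
Implicit Types (u v w x y : Gamma) (T U : {set Gamma}).
Local Notation A := (raag Gamma).

Lemma raag_mulE (g h : A) : g * h = raag_mul g h. Proof. by []. Qed.

Lemma word_class_cat (s t : word Gamma) : word_class (s ++ t) = word_class s * word_class t.
Proof. by rewrite raag_mulE raag_classM. Qed.

Lemma word_class0 : word_class [::] = 1 :> A. Proof. by []. Qed.

Lemma vgenV v : word_class [:: (v, false)] = (vgen v)^-1 :> A.
Proof.
apply/esym/mulg1_eq; rewrite -word_class_cat -word_class0.
by apply/word_classP; apply: (word_cancel [::] [::] v true).
Qed.

Lemma vgen_commute v w : adj v w -> commute (vgen v) (vgen w).
Proof.
move=> vw; rewrite /commute -!word_class_cat; apply/word_classP.
exact: (word_comm [::] [::] true true vw).
Qed.

Lemma vgen_st v w : w \in st v -> commute (vgen v) (vgen w).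
Proof.
by rewrite !inE => /orP[/eqP->|]; [apply: commute_refl|apply: vgen_commute].
Qed.

Definition lgen (l : Gamma * bool) : A := if l.2 then vgen l.1 else (vgen l.1)^-1.

Lemma word_class_cons l (s : word Gamma) : word_class (l :: s) = lgen l * word_class s.
Proof.
by rewrite -cat1s word_class_cat; case: l => v [] //; rewrite vgenV.
Qed.

Lemma raag_ind (Q : A -> Prop) :
  Q 1 -> (forall l g, Q g -> Q (lgen l * g)) -> forall g, Q g.
Proof.
move=> Q1 QM g; rewrite -[g]raag_reprK.
by elim: (repr g) => [|l s IH] //; rewrite word_class_cons; apply: QM.
Qed.

Lemma raag_gen (H : set A) : is_subgroup H -> (forall v, H (vgen v)) -> forall g, H g.
Proof.
move=> sH Hv; elim/raag_ind; first exact: is_subgroup1.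
move=> [v b] g Hg; apply: is_subgroupM => //; rewrite /lgen; case: b => //=.
exact: is_subgroupV.
Qed.

Lemma raag_hom_eq (H : groupType) (f g : {hom A -> H}) :
  (forall v, f (vgen v) = g (vgen v)) -> f =1 g.
Proof. by move=> fg; apply: raag_gen fg; apply: eq_hom_subgroup. Qed.

Section Lift.
Variables (H : groupType) (c : Gamma -> H).

Definition word_eval (s : word Gamma) : H :=
  \prod_(l <- s) (if l.2 then c l.1 else (c l.1)^-1).

(** The universal property of A: [repr] picks an arbitrary word, and commuting images make the value
    independent of it. *)
Definition raag_lift (g : A) : H := word_eval (repr g).

Hypothesis c_comm : forall v w, adj v w -> commute (c v) (c w).

Lemma word_eval_eq s t : word_eq s t -> word_eval s = word_eval t.
Proof.
elim=> {s t} [s|s t _ ->|s t u _ -> _ ->|s t v b|s t v w b b' vw] //.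
  rewrite /word_eval !big_cat !big_cons /= big_nil mulg1.
  by case: b; rewrite /= ?mulgV ?mulVg mul1g.
rewrite /word_eval !big_cat !big_cons /= big_nil !mulg1; do 2!congr (_ * _).
suff: commute (if b then c v else (c v)^-1) (if b' then c w else (c w)^-1) by [].
have sgn (d : bool) (g h : H) : commute g h -> commute g (if d then h else h^-1).
  by case: d => // /commuteV.
by apply/sgn/commute_sym/sgn/commute_sym/c_comm.
Qed.

Lemma raag_lift_word s : raag_lift (word_class s) = word_eval s.
Proof. exact/word_eval_eq/word_repr. Qed.

Lemma raag_liftM : {morph raag_lift : g h / g * h}.
Proof.
move=> g h; rewrite -[g]raag_reprK -[h]raag_reprK -word_class_cat !raag_lift_word.
exact: big_cat.
Qed.

Lemma raag_lift_vgen v : raag_lift (vgen v) = c v.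
Proof. by rewrite raag_lift_word /word_eval big_seq1. Qed.

End Lift.

Definition retr_gen T v : A := if v \in T then vgen v else 1.

Lemma retr_gen_commute T v w : adj v w -> commute (retr_gen T v) (retr_gen T w).
Proof.
rewrite /retr_gen => /vgen_commute vw.
by do 2!case: ifP => _ //; try exact: commute1; apply/commute_sym/commute1.
Qed.

(** An endomorphism of A rather than a map to [raag_on T], so that retractions compose and
    membership in A_T becomes the equation [retr T g = g]. *)
Definition retr T : A -> A := raag_lift (retr_gen T).
HB.instance Definition _ T :=
  isGroupMorphism.Build A A (retr T) (morph_divg (raag_liftM (@retr_gen_commute T))).

Lemma retr_vgen T v : retr T (vgen v) = if v \in T then vgen v else 1.
Proof. exact: (raag_lift_vgen (@retr_gen_commute T)). Qed.

Lemma special_subgroup T : is_subgroup (special T).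
Proof. exact: generated_subgroup. Qed.
Hint Resolve special_subgroup : core.

Lemma special1 T : special T (1 : A).
Proof. exact: is_subgroup1. Qed.

Lemma specialM T g h : special T g -> special T h -> special T (g * h).
Proof. exact: is_subgroupM. Qed.

Lemma specialV T g : special T g -> special T g^-1.
Proof. exact: is_subgroupV. Qed.

Lemma specialF T g h : special T g -> special T h -> special T (g / h).
Proof. exact: is_subgroupF. Qed.

Lemma specialJ T g h : special T g -> special T h -> special T (g ^ h).
Proof. exact: is_subgroupJ. Qed.

Lemma special_vgen T v : v \in T -> special T (vgen v).
Proof. by move=> vT; apply: sub_generated; exists v. Qed.

Lemma special_sub T (H : set A) :
  is_subgroup H -> (forall v, v \in T -> H (vgen v)) -> special T `<=` H.
Proof. by move=> sH HT; apply: generated_sub => // _ [v vT <-]; apply: HT. Qed.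

Lemma specialS T U : T \subset U -> special T `<=` special U.
Proof. by move=> /fintype.subsetP TU; apply: special_sub => // v /TU; apply: special_vgen. Qed.

Lemma retr_special T g : special T (retr T g).
Proof.
apply: (@raag_gen [set g | special T (retr T g)]) => [|v].
  exact: (@preim_subgroup _ _ (retr T : {hom _ -> _})).
rewrite /= retr_vgen; case: ifP => [|_]; first exact: special_vgen.
exact: is_subgroup1.
Qed.

Lemma retr_id T g : special T g -> retr T g = g.
Proof.
have sH : is_subgroup [set g | retr T g = g].
  exact: (eq_hom_subgroup (retr T : {hom _ -> _}) (idfun : {hom _ -> _})).
by apply: (special_sub sH) => v vT; rewrite /= retr_vgen vT.
Qed.

Lemma retr_retr T U g : retr T (retr U g) = retr (T :&: U) g.
Proof.
apply: (@raag_hom_eq _ (retr T \o retr U : {hom _ -> _})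
  (retr (T :&: U) : {hom _ -> _})) => v.
rewrite /= !retr_vgen inE; case: (v \in U); first by rewrite retr_vgen andbT.
by rewrite andbF gmulf1.
Qed.

Lemma specialI T U g : special T g -> special U g -> special (T :&: U) g.
Proof.
move=> /retr_id gT /retr_id gU; rewrite -gT -{1}gU retr_retr; exact: retr_special.
Qed.

Lemma retr_disjoint T U g : T :&: U = finset.set0 -> special U g -> retr T g = 1.
Proof.
move=> TU /retr_id <-; rewrite retr_retr TU.
apply: (@raag_gen [set g | retr finset.set0 g = 1]) => [|v /=]; last first.
  by rewrite retr_vgen inE.
exact: (preim_subgroup (retr finset.set0 : {hom _ -> _}) (one_subgroup _)).
Qed.

Lemma special_commute T U g h :
  (forall v w, v \in T -> w \in U -> commute (vgen v) (vgen w)) ->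
  special T g -> special U h -> commute g h.
Proof.
move=> TU gT; apply: special_sub => [|w wU]; first exact: commute_subgroup.
apply/commute_sym; move: gT; apply: special_sub => [|v vT]; first exact: commute_subgroup.
exact/commute_sym/TU.
Qed.

Lemma special_commute1 T u g :
  (forall v, v \in T -> commute (vgen u) (vgen v)) -> special T g -> commute (vgen u) g.
Proof. by move=> uT; apply: special_sub => //; apply: commute_subgroup. Qed.

End Raag.

#[global] Hint Resolve special_subgroup : core.

(** * Centralizers of vertices *)

Section Pilings.
Variable Gamma : sgraph.
Implicit Types (u v w x y : Gamma) (l : Gamma * bool) (s t : word Gamma).
Local Notation A := (raag Gamma).

(* Pilings in the sense of Crisp, Godelle and Wiest: one stack per vertex. A   *)
(* letter pushes its sign on its own stack and a bead None on the stacks of    *)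
(* the vertices it does not commute with; it cancels against an opposite sign. *)
Definition piling := {ffun Gamma -> seq (option bool)}.
Implicit Types p q : piling.

Definition far v x := (x != v) && ~~ adj v x.

Definition push l p : piling :=
  [ffun x => if x == l.1 then Some l.2 :: p x
             else if far l.1 x then None :: p x else p x].
Definition pop v p : piling :=
  [ffun x => if (x == v) || far v x then behead (p x) else p x].
Definition cancels l p := ohead (p l.1) == Some (Some (~~ l.2)).
Definition act l p : piling := if cancels l p then pop l.1 p else push l p.

Definition piling0 : piling := [ffun=> [::]].
Definition pile s : piling := foldr act piling0 s.

(** Only pilings built by non-cancelling pushes. On arbitrary stacks [act] violates the relations,
    since [pop] may discard entries other than None from the far stacks. *)
Inductive represents : piling -> A -> Prop :=
| represents0 : represents piling0 1
| representsS l p g : represents p g -> ~~ cancels l p ->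
    represents (push l p) (lgen l * g).

Lemma pushK v b p : pop v (push (v, b) p) = p.
Proof. by apply/ffunP => x; rewrite !ffunE; case: eqP => //= _; case: far. Qed.

Lemma push_adj v b p w : adj v w -> push (v, b) p w = p w.
Proof.
move=> vw; rewrite ffunE /far /= vw andbF; case: eqP => // wv.
by rewrite wv adj_irr in vw.
Qed.

Lemma pop_adj v p w : adj v w -> pop v p w = p w.
Proof.
move=> vw; rewrite ffunE /far /= vw andbF orbF; case: eqP => // wv.
by rewrite wv adj_irr in vw.
Qed.

Lemma act_adj v b p w : adj v w -> act (v, b) p w = p w.
Proof. by move=> vw; rewrite /act; case: ifP; rewrite (push_adj, pop_adj). Qed.

Lemma pushC v b w c p : adj v w ->
  push (v, b) (push (w, c) p) = push (w, c) (push (v, b) p).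
Proof.
move=> vw; apply/ffunP => x; rewrite !ffunE /far /=.
have nvw : v != w by apply: contraTneq vw => ->; rewrite adj_irr.
have [xv|xv] := eqVneq x v; have [xw|xw] := eqVneq x w => //=.
- by rewrite -xv -xw eqxx in nvw.
- by rewrite xv adj_sym vw.
- by rewrite xw vw.
- by case: (adj v x); case: (adj w x).
Qed.

Lemma lgenV v b : (lgen (v, b))^-1 = lgen (v, ~~ b) :> A.
Proof. by case: b; rewrite /lgen //= invgK. Qed.

Lemma lgen_commute v b w c : adj v w -> commute (lgen (v, b)) (lgen (w, c) : A).
Proof.
move=> /vgen_commute vw; rewrite /lgen /=.
have sgn (d : bool) (g h : A) : commute g h -> commute g (if d then h else h^-1).
  by case: d => // /commuteV.
by apply/sgn/commute_sym/sgn/commute_sym.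
Qed.

(** All letters pushed after the sign on top of the stack of v are adjacent to v, as any other would
    leave an entry there. They commute with v, so the letter v can be brought to the front. *)
Lemma represents_top p g v b : represents p g -> ohead (p v) = Some (Some b) ->
  exists2 q, p = push (v, b) q &
    ~~ cancels (v, b) q /\ represents q ((lgen (v, b))^-1 * g).
Proof.
elim=> {p g} [|[w c] p g pg IH cp]; first by rewrite ffunE.
have [->|vw] := eqVneq v w.
  rewrite ffunE eqxx /= => -[<-]; exists p => //; split=> //.
  by rewrite mulKg.
have [wv|wv] := boolP (adj w v); last by rewrite ffunE (negPf vw) /far vw wv.
rewrite push_adj // => /IH[q pq [cq qg]]; exists (push (w, c) q).
  by rewrite pq pushC.
split; first by rewrite /cancels push_adj.
have -> : (lgen (v, b))^-1 * (lgen (w, c) * g) = lgen (w, c) * ((lgen (v, b))^-1 * g).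
  by rewrite !mulgA lgenV lgen_commute // adj_sym.
by apply: representsS; rewrite // /cancels -(@push_adj v b q) -?pq // adj_sym.
Qed.

Lemma represents_act l p g : represents p g -> represents (act l p) (lgen l * g).
Proof.
move=> pg; rewrite /act; case: ifP => [/eqP lp|/negbT]; last exact: representsS.
have [q -> [_]] := represents_top pg lp.
rewrite pushK lgenV negbK; by case: l {lp}.
Qed.

Lemma pile_represents s : represents (pile s) (word_class s).
Proof.
elim: s => [|l s IH]; first exact: represents0.
by rewrite word_class_cons; apply: represents_act.
Qed.

Lemma act_cancel v b p g : represents p g -> act (v, b) (act (v, ~~ b) p) = p.
Proof.
move=> pg; rewrite {2}/act; case: ifP => [/eqP|vp]; last first.
  by rewrite /act /cancels ffunE eqxx /= eqxx pushK.
rewrite /= negbK => /(represents_top pg)[q -> [vq _]].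
by rewrite pushK /act (negPf vq).
Qed.

(** Adjacent letters leave each other's stacks alone, so neither affects whether the other
    cancels. *)
Lemma act_comm v b w c p g : represents p g -> adj v w ->
  act (v, b) (act (w, c) p) = act (w, c) (act (v, b) p).
Proof.
move=> pg vw; have wv : adj w v by rewrite adj_sym.
rewrite {1 3}/act /cancels /= !act_adj // -!/(cancels (_, _) _) /act.
case: ifP => vp; case: ifP => wp; last exact: pushC.
- have [q pq [_ qg]] := represents_top pg (eqP vp).
  have : ohead (q w) = Some (Some (~~ c)).
    by move: wp; rewrite pq /cancels push_adj // => /eqP.
  move=> /(represents_top qg)[r qr _]; rewrite pq qr.
  rewrite pushK pushK pushC // pushK.
  by rewrite pushK.
- have [q -> _] := represents_top pg (eqP vp).
  by rewrite pushK pushC // pushK.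
- have [q -> _] := represents_top pg (eqP wp).
  by rewrite pushK pushC // pushK.
Qed.

Lemma pile_cat s t : pile (s ++ t) = foldr act (pile t) s.
Proof. exact: foldr_cat. Qed.

Lemma pile_eq s t : word_eq s t -> pile s = pile t.
Proof.
elim=> {s t} [s|s t _ ->|s t u _ -> _ ->|s t v b|s t v w b c vw] //.
  by rewrite !pile_cat /= (act_cancel _ _ (pile_represents t)).
by rewrite !pile_cat /= (act_comm _ _ (pile_represents t)).
Qed.

(** [represents] only ever pushes, so a letter outside st(u) leaves on the stack of u a bead None
    that is never removed. *)
Lemma represents_st p g u : represents p g -> None \notin p u -> special (st u) g.
Proof.
elim=> {p g} [|[w c] p g pg IH cp]; first by move=> _; apply: is_subgroup1.
rewrite ffunE /= /far => up.
have [wu gu] : w \in st u /\ special (st u) g.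
  move: up; rewrite !inE (eq_sym w) (adj_sym u).
  have [_|_] := eqVneq u w; first by rewrite inE => /IH.
  by case: (adj w u) => //= /IH.
apply: specialM => //; rewrite /lgen /=.
by case: (c); [|apply: specialV]; apply: special_vgen.
Qed.

(** The stack from its topmost bead None downwards: letters u alter only the signs above that
    bead. *)
Definition strip (r : seq (option bool)) := drop (index None r) r.

Lemma strip_act u b p : strip (act (u, b) p u) = strip (p u).
Proof.
rewrite /act /cancels; case: ifP => [/=|_]; last by rewrite ffunE eqxx.
by rewrite ffunE eqxx; case: (p u) => //= o r /eqP[->].
Qed.

Lemma act_suffix u l p a k : p u = a ++ nseq k (Some true) ->
  exists a' k', (k <= k'.+1)%N /\ act l p u = a' ++ nseq k' (Some true).
Proof.
move=> pu; rewrite /act; case: ifP => _; rewrite ffunE pu.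
  case: ifP => _; last by exists a, k.
  case: a {pu} => [|o a]; last by exists a, k.
  by exists [::], k.-1; split; [exact: leqSpred|case: k].
case: ifP => _; first by exists (Some l.2 :: a), k.
by case: ifP => _; [exists (None :: a), k|exists a, k].
Qed.

Lemma foldr_act_suffix u s p k : p u = nseq k (Some true) ->
  exists a k', (k <= size s + k')%N /\ foldr act p s u = a ++ nseq k' (Some true).
Proof.
move=> pu; elim: s => [|l s [a [k' [kk' IH]]]]; first by exists [::], k.
have [a' [k'' [k'k'' E]]] := act_suffix l IH.
by exists a', k''; split=> //=; lia.
Qed.

Lemma vgenX u n : word_class (nseq n (u, true)) = vgen u ^+ n :> A.
Proof. by elim: n => [//|n IH]; rewrite expgS -IH word_class_cons. Qed.

(* If g commutes with u then so do their powers; u^n g has the beads None of   *)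
(* the stack u of g at the same height, while g u^n has signs + below them, in *)
(* number growing with n: there are no such beads.                             *)
Lemma centralizer_vgen u (g : A) : commute (vgen u) g -> special (st u) g.
Proof.
move=> ug; rewrite -[g]raag_reprK; set s := repr g.
apply: represents_st (pile_represents s) _.
(* The word s destroys at most [size s] of the n signs, so more than [size (pile s u)] of them
   survive at the bottom. *)
apply/negP => su; pose n := (size s + size (pile s u)).+1.
pose un : word Gamma := nseq n (u, true).
have E : pile (un ++ s) = pile (s ++ un).
  apply/pile_eq/word_classP; rewrite !word_class_cat raag_reprK vgenX.
  exact/commute_sym/commuteX/commute_sym.
have Eun : pile un u = nseq n (Some true).
  rewrite /un; elim: (n) => [|m IH]; first by rewrite ffunE.
  by rewrite /= /act /cancels /= IH; case: (m) IH => [|k] IH; rewrite ffunE eqxx IH.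
have [a [k [nk Ea]]] := foldr_act_suffix s Eun.
have strip_s : strip (pile (un ++ s) u) = strip (pile s u).
  by rewrite pile_cat /un; elim: (n) => //= m IH; rewrite strip_act.
move: strip_s; rewrite E pile_cat Ea /strip index_cat => /(congr1 size).
have Nk : None \notin nseq k (Some true) by rewrite mem_nseq andbF.
have {}su : (index None (pile s u) < size (pile s u))%N by rewrite index_mem.
case: ifP => aN; rewrite !size_drop size_cat size_nseq.
  have {}aN : (index None a < size a)%N by rewrite index_mem.
  by move: nk; rewrite /n; clear -aN su; lia.
by rewrite (memNindex Nk) size_nseq subnn; clear -su; lia.
Qed.

End Pilings.

(** * Exponent sums and Magnus coefficients *)

(* (a, b, c) stands for the unitriangular matrix [[1,a,c],[0,1,b],[0,0,1]]. *)
Definition heisenberg : Type := (int * int * int)%type.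
HB.instance Definition _ := Choice.on heisenberg.

Section Heisenberg.
Implicit Types p q r : heisenberg.

Definition heis_mul p q : heisenberg :=
  (p.1.1 + q.1.1, p.1.2 + q.1.2, p.2 + q.2 + p.1.1 * q.1.2)%R.
Definition heis_one : heisenberg := (0, 0, 0)%R.
Definition heis_inv p : heisenberg :=
  (- p.1.1, - p.1.2, - p.2 + p.1.1 * p.1.2)%R.

Lemma heis_mulA : associative heis_mul.
Proof. by case=> [[a b] c] [[d e] f] [[g h] i]; congr (_, _, _); rewrite /=; ring. Qed.
Lemma heis_mul1 : left_id heis_one heis_mul.
Proof. by case=> [[a b] c]; congr (_, _, _); rewrite /=; ring. Qed.
Lemma heis_mulr1 : right_id heis_one heis_mul.
Proof. by case=> [[a b] c]; congr (_, _, _); rewrite /=; ring. Qed.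
Lemma heis_mulV : left_inverse heis_one heis_inv heis_mul.
Proof. by case=> [[a b] c]; congr (_, _, _); rewrite /=; ring. Qed.
Lemma heis_mulrV : right_inverse heis_one heis_inv heis_mul.
Proof. by case=> [[a b] c]; congr (_, _, _); rewrite /=; ring. Qed.

HB.instance Definition _ :=
  isGroup.Build heisenberg heis_mulA heis_mul1 heis_mulr1 heis_mulV heis_mulrV.

Lemma heis_mulE p q : p * q = heis_mul p q. Proof. by []. Qed.
Lemma heis_invE p : p^-1 = heis_inv p. Proof. by []. Qed.

End Heisenberg.

Section Coefficients.
Variable Gamma : sgraph.
Implicit Types (u v w x y : Gamma) (T U Z : {set Gamma}).
Local Notation A := (raag Gamma).
Implicit Types g h : A.

Lemma stC v w : (v \in st w) = (w \in st v).
Proof. by rewrite !inE eq_sym adj_sym. Qed.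

(** Dropping u when it lies in st(x) makes the images of adjacent vertices commute. In particular u
    = x is allowed, which [exps] uses to read off exponent sums. *)
Definition heis_gen x u v : heisenberg :=
  if v == x then (1, 0, 0)%R
  else if (v == u) && (u \notin st x) then (0, 1, 0)%R else heis_one.

Lemma heis_gen_commute x u v w :
  adj v w -> commute (heis_gen x u v) (heis_gen x u w).
Proof.
move=> vw; rewrite /heis_gen.
have [vx|_] := eqVneq v x; have [wx|_] := eqVneq w x.
- exact: commute_refl.
- case: ifP => [/andP[/eqP wu]|_]; last exact: commute1.
  by rewrite !inE -wu -vx vw orbT.
- case: ifP => [/andP[/eqP vu]|_]; last exact/commute_sym/commute1.
  by rewrite !inE -vu -wx adj_sym vw orbT.
do 2!case: ifP => _; do ?exact: commute_refl; do ?exact: commute1.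
exact/commute_sym/commute1.
Qed.

Definition heis_map x u : A -> heisenberg := raag_lift (heis_gen x u).
HB.instance Definition _ x u := isGroupMorphism.Build A heisenberg (heis_map x u)
  (morph_divg (raag_liftM (@heis_gen_commute x u))).

Lemma heis_map_vgen x u v : heis_map x u (vgen v) = heis_gen x u v.
Proof. exact: raag_lift_vgen (@heis_gen_commute x u) v. Qed.

Definition exps x g : int := (heis_map x x g).1.1.
(** For u outside st(x), the signed number of pairs formed by a letter x and a later letter u. *)
Definition magnus x u g : int := (heis_map x u g).2.

Lemma expsM x g h : exps x (g * h) = (exps x g + exps x h)%R.
Proof. by rewrite /exps gmulfM heis_mulE. Qed.

Lemma exps1 x : exps x 1 = 0%R.
Proof. by rewrite /exps gmulf1. Qed.

Lemma expsV x g : exps x g^-1 = (- exps x g)%R.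
Proof. by rewrite /exps gmulfV heis_invE. Qed.

Lemma expsJ x g h : exps x (g ^ h) = exps x g.
Proof. by rewrite conjgE !expsM expsV; lia. Qed.

Lemma expsX x g n : exps x (g ^+ n) = (exps x g *+ n)%R.
Proof. by elim: n => [|n IH]; rewrite ?exps1 // expgS expsM IH mulrS. Qed.

Lemma exps_vgen x v : exps x (vgen v) = (v == x)%:R%R.
Proof.
by rewrite /exps heis_map_vgen /heis_gen; case: eqP.
Qed.

Lemma exps_subgroup x : is_subgroup [set g | exps x g = 0%R].
Proof.
apply/is_subgroupP; split=> [|g h /= gx hx]; first exact: exps1.
by rewrite /= expsM expsV gx hx.
Qed.

Lemma heis_map_fst x u g : (heis_map x u g).1.1 = exps x g.
Proof.
apply: (@raag_gen _ [set g | (heis_map x u g).1.1 = exps x g]) => [|v] /=.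
  apply/is_subgroupP; split=> [|a b /= ax bx]; first by rewrite /= exps1 gmulf1.
  by rewrite /= gmulfF expsM expsV heis_mulE heis_invE /= ax bx.
by rewrite exps_vgen heis_map_vgen /heis_gen; case: eqP => // _; case: ifP.
Qed.

Lemma heis_map_snd x u g : u \notin st x -> (heis_map x u g).1.2 = exps u g.
Proof.
move=> ux; apply: (@raag_gen _ [set g | (heis_map x u g).1.2 = exps u g]) => [|v] /=.
  apply/is_subgroupP; split=> [|a b /= ax bx]; first by rewrite /= exps1 gmulf1.
  by rewrite /= gmulfF expsM expsV heis_mulE heis_invE /= ax bx.
rewrite exps_vgen heis_map_vgen /heis_gen ux andbT; case: (eqVneq v x) => [->|_].
  by move: ux; rewrite !inE negb_or eq_sym => /andP[/negPf->].
by case: eqP.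
Qed.

Lemma magnusM x u g h : u \notin st x ->
  magnus x u (g * h) = (magnus x u g + magnus x u h + exps x g * exps u h)%R.
Proof.
by move=> ux; rewrite /magnus gmulfM heis_mulE /= heis_map_fst heis_map_snd.
Qed.

Lemma magnusJ x u g h : u \notin st x ->
  magnus x u (g ^ h) = (magnus x u g + exps x g * exps u h - exps u g * exps x h)%R.
Proof.
move=> ux; rewrite conjgE !magnusM // !expsM expsV.
(* Expanding this product gives the coefficient of h^-1. *)
have : magnus x u (h^-1 * h) = 0%R by rewrite mulVg /magnus gmulf1.
rewrite magnusM // expsV => H; apply/eqP; rewrite -subr_eq0 -[X in _ == X]H; apply/eqP; ring.
Qed.

Lemma magnus_vgen x u : magnus x u (vgen x) = 0%R.
Proof. by rewrite /magnus heis_map_vgen /heis_gen eqxx. Qed.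

Lemma exps_special T x g : x \notin T -> special T g -> exps x g = 0%R.
Proof.
move=> xT; apply: (special_sub (exps_subgroup x)) => v vT /=.
by rewrite exps_vgen; case: eqP => // vx; rewrite -vx vT in xT.
Qed.

Lemma magnus_special T x u g : x \notin T -> u \notin T -> special T g ->
  magnus x u g = 0%R.
Proof.
move=> xT uT gT; suff : heis_map x u g = 1 by rewrite /magnus => ->.
move: gT; apply: (special_sub (preim_subgroup (heis_map x u : {hom _ -> _}) (one_subgroup _))).
move=> v vT /=; rewrite heis_map_vgen /heis_gen.
case: eqP => [vx|_]; first by rewrite -vx vT in xT.
by case: eqP => [vu|//]; rewrite -vu vT in uT.
Qed.

Lemma exps_hom (f : {hom A -> A}) y g :
  exps y (f g) = (\sum_z exps z g * exps y (f (vgen z)))%R.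
Proof.
apply: (@raag_gen _ [set g | exps y (f g) = (\sum_z exps z g * exps y (f (vgen z)))%R])
  => [|v] /=.
  apply/is_subgroupP; split=> [|a b /= ay b_y].
    by rewrite /= gmulf1 exps1 big1 // => z _; rewrite exps1 mul0r.
  rewrite /= gmulfF expsM expsV ay b_y -sumrB; apply: eq_bigr => z _.
  by rewrite expsM expsV mulrBl.
rewrite (bigD1 v) //= exps_vgen eqxx mul1r big1 ?addr0 // => z zv.
by rewrite exps_vgen eq_sym (negPf zv) mul0r.
Qed.

(** Since u commutes with A_U, an element of A_U is a power of u times its image under the
    retraction killing u; exponent 0 leaves that image alone. *)
Lemma special_exps0 U u g : (forall v, v \in U -> v \in st u) ->
  special U g -> exps u g = 0%R -> special (U :\ u) g.
Proof.
move=> Uu gU g0; pose r := retr (~: [set u]%SET) : {hom A -> A}.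
have rU h : special U h -> special (U :\ u) (r h).
  move=> /retr_id hU; rewrite /r /= -hU retr_retr.
  by rewrite finset.setIC -finset.setDE; apply: retr_special.
have uU h n : special U h -> commute (vgen u ^+ n) h.
  move=> hU; apply/commute_sym/commuteX/commute_sym.
  by apply: special_commute1 hU => v /Uu /vgen_st.
have rUU h : special U h -> special U (r h).
  by move=> /rU; apply: specialS; apply: subsetDl.
(* Powers are indexed by naturals, so the exponent of u is written as the difference m - n. *)
suff [n [m E]] : exists n m, g * vgen u ^+ n = vgen u ^+ m * r g.
  have nm : n = m.
    move: (congr1 (exps u) E); rewrite !expsM !expsX exps_vgen eqxx g0.
    by rewrite (exps_special _ (rU _ gU)) ?inE ?eqxx // addr0 add0r !pmulrn; lia.
  move: E; rewrite nm (uU _ m (rUU _ gU)) => /mulIg ->; exact: rU.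
suff : (special U `&` [set g | exists n m, g * vgen u ^+ n = vgen u ^+ m * r g]) g.
  by case.
move: g gU {g0}; apply: special_sub => [|v vU].
  apply/is_subgroupP; split=> [|a b [aU [n [m Ea]]] [bU [k [l Eb]]]].
    by split; [exact: special1|exists 0, 0; rewrite gmulf1].
  split; first exact: specialF.
  exists (n + l)%N, (m + k)%N; rewrite gmulfF !expgnDr.
  have -> : a / b * (vgen u ^+ n * vgen u ^+ l) = a * vgen u ^+ n * (b^-1 * vgen u ^+ l).
    by rewrite -!mulgA; congr (_ * _); rewrite !mulgA (uU b^-1) //; apply: specialV.
  have -> : b^-1 * vgen u ^+ l = vgen u ^+ k / r b.
    by apply: (mulIg (r b)); rewrite -mulgA -Eb mulgVK mulKg.
    by rewrite Ea -!mulgA; congr (_ * _); rewrite !mulgA (uU (r a)) //; apply: rUU.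
split; first exact: special_vgen.
rewrite /= retr_vgen !inE; case: eqP => [->|_]; last by exists 0, 0; rewrite mulg1 mul1g.
by exists 0, 1%N; rewrite !mulg1.
Qed.

(** A clique generates a free abelian group, so vertices of exponent 0 can be discarded; those of U
    outside Z go one at a time. *)
Lemma special_clique U Z g : {in U &, forall v w, w \in st v} ->
  special U g -> (forall u, u \in U -> exps u g != 0%R -> u \in Z) ->
  special (U :&: Z) g.
Proof.
move: {2}(#|_|) (leqnn #|U :\: Z|) => n; elim: n U => [|n IH] U.
  rewrite leqn0 cards_eq0 finset.setD_eq0 => /finset.setIidPl -> //.
move=> leUZ Uc gU gZ; have [E|[u]] := set_0Vmem (U :\: Z).
  by move/eqP: E; rewrite finset.setD_eq0 => /finset.setIidPl ->.
rewrite inE => /andP[uZ uU].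
have g0 : exps u g = 0%R by apply/eqP; apply: contraNT uZ; apply: gZ.
have gUu : special (U :\ u) g by apply: special_exps0 => // v; apply: Uc.
have : special ((U :\ u) :&: Z) g.
  apply: IH => //.
  - rewrite -ltnS; apply: leq_trans leUZ; apply: proper_card.
    rewrite properE; apply/andP; split; first exact/finset.setSD/subsetDl.
    by apply/subsetPn; exists u; rewrite !inE ?uZ ?uU ?eqxx.
  - by move=> v w /setD1P[_ vU] /setD1P[_ wU]; apply: Uc.
  - by move=> v /setD1P[_ vU]; apply: gZ.
by apply: specialS; apply: finset.setSI; apply: subsetDl.
Qed.

Lemma special_clique1 U g : {in U &, forall v w, w \in st v} ->
  special U g -> (forall u, u \in U -> exps u g = 0%R) -> g = 1.
Proof.
move=> Uc gU g0; have : special (U :&: finset.set0) g.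
  by apply: special_clique => // u /g0 ->; rewrite eqxx.
rewrite finset.setI0 => /retr_id <-.
by apply: retr_disjoint gU; rewrite finset.set0I.
Qed.

Lemma exps_exists Z (c : Gamma -> int) :
  exists2 k, special Z k & forall u, exps u k = (if u \in Z then c u else 0)%R.
Proof.
suff [k kZ kc] : exists2 k, special Z k &
    forall u, exps u k = (if u \in enum Z then c u else 0)%R.
  by exists k => // u; rewrite kc mem_enum.
have : {subset enum Z <= Z} by move=> u; rewrite mem_enum.
elim: (enum Z) (enum_uniq (mem Z)) => [_ _|v s IH /= /andP[vs us] sZ].
  by exists 1 => [|u]; [exact: special1|rewrite exps1].
have [|k kZ kc] := IH us; first by move=> w ws; apply: sZ; rewrite inE ws orbT.
have vZ : special Z (vgen v) by apply: special_vgen; apply: sZ; rewrite inE eqxx.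
pose h : A := if c v is Posz n then vgen v ^+ n else vgen v ^- `|c v|.
have hZ : special Z h.
  have X n : special Z (vgen v ^+ n).
    by elim: n => [|n IHn]; [apply: special1|rewrite expgS; apply: specialM].
  by rewrite /h; case: (c v) => n; [|apply: specialV]; apply: X.
exists (h * k) => [|u]; first exact: specialM.
have -> : exps u (h * k) = ((v == u)%:R * c v + exps u k)%R.
  rewrite expsM; congr (_ + _)%R; rewrite /h; case: (c v) => n.
    by rewrite expsX exps_vgen pmulrn -mulrzr intz.
  by rewrite expsV expsX exps_vgen pmulrn -mulrzr intz NegzE mulrN.
rewrite kc inE eq_sym; have [->|_] := eqVneq u v; last by rewrite mul0r add0r.
by rewrite (negPf vs) mul1r addr0.
Qed.

End Coefficients.

(** * Classes of vertices *)

Section Classes.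
Variable Gamma : sgraph.
Implicit Types (u v w x y z m : Gamma).

Lemma in_st v w : (w \in st v) = (w == v) || adj v w.
Proof. by rewrite !inE. Qed.

Lemma in_lk v w : (w \in lk v) = adj v w.
Proof. by rewrite inE. Qed.

Lemma vleP v w : reflect (forall x, adj v x -> x = w \/ adj w x) (vle v w).
Proof.
apply: (iffP fintype.subsetP) => vw x => [vx|]; last first.
  by rewrite in_lk => /vw[->|wx]; rewrite in_st ?eqxx // wx orbT.
by have := vw x; rewrite in_lk in_st => /(_ vx)/orP[/eqP|]; [left|right].
Qed.

Lemma vle_refl v : vle v v.
Proof. by apply/vleP => x; right. Qed.

Lemma vle_trans v w x : vle v w -> vle w x -> vle v x.
Proof.
move=> vw wx; apply/vleP => u vu.
have [uw|wu] := vleP _ _ vw u vu; last exact: vleP _ _ wx u wu.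
move: vu; rewrite {u}uw adj_sym => wv; have [vx|xv] := vleP _ _ wx v wv.
  by right; rewrite -vx adj_sym.
move: xv; rewrite adj_sym => /(vleP _ _ vw)[xw|]; first by left.
by rewrite adj_sym; right.
Qed.

Lemma in_cls v w : (w \in cls v) = vle v w && vle w v.
Proof. by rewrite inE. Qed.

Lemma cls_refl v : v \in cls v.
Proof. by rewrite in_cls vle_refl. Qed.

Lemma cls_sym v w : (w \in cls v) = (v \in cls w).
Proof. by rewrite !in_cls andbC. Qed.

Lemma cls_trans v w x : w \in cls v -> x \in cls w -> x \in cls v.
Proof.
rewrite !in_cls => /andP[vw wv] /andP[wx xw].
by rewrite (vle_trans vw wx) (vle_trans xw wv).
Qed.

Lemma cls_eqP v w : reflect (cls v = cls w) (w \in cls v).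
Proof.
apply: (iffP idP) => [vw|->]; last exact: cls_refl.
apply/setP => x; apply/idP/idP; last exact: cls_trans.
by apply: cls_trans; rewrite cls_sym.
Qed.

Lemma cls_le v w x : w \in cls v -> vle w x -> vle v x.
Proof. by rewrite in_cls => /andP[vw _]; apply: vle_trans. Qed.

Lemma maximalP v w : maximal v -> vle v w -> w \in cls v.
Proof. by move=> /forallP/(_ w)/implyP mv /mv/eqP/esym/cls_eqP. Qed.

Lemma maximal_cls v w : w \in cls v -> maximal v -> maximal w.
Proof.
move=> vw mv; apply/forallP => x; apply/implyP => wx.
have /cls_eqP <- := maximalP mv (cls_le vw wx).
by apply/eqP/cls_eqP.
Qed.

(** Take, among the vertices above x, one with the most vertices below it: a vertex above that one
    has the same lower set by cardinality. *)
Lemma exists_maximal x : exists2 m, maximal m & vle x m.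
Proof.
pose d m := #|[set y | vle y m]%SET|.
have [m xm dm] := @arg_maxnP _ x (vle x) d (vle_refl x); exists m => //.
apply/forallP => w; apply/implyP => mw; apply/eqP/cls_eqP.
rewrite in_cls mw andbT; have sub : [set y | vle y m]%SET \subset [set y | vle y w]%SET.
  by apply/fintype.subsetP => y; rewrite !inE => /vle_trans; apply.
have : [set y | vle y m]%SET == [set y | vle y w]%SET.
  by rewrite eqEcard sub; apply: dm; apply: vle_trans mw.
by move=> /eqP/setP/(_ w); rewrite !inE vle_refl.
Qed.

Lemma in_L v w : (w \in L v) = (w \notin cls v) && adj v w.
Proof. by rewrite finset.in_setD in_lk. Qed.

Lemma L_adj v w : w \in L v -> adj v w.
Proof. by rewrite in_L => /andP[]. Qed.

Lemma L_cls v w v' : v' \in cls v -> w \in L v -> w \in L v'.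
Proof.
move=> vv'; rewrite !in_L => /andP[wv /[dup] vw]; rewrite (cls_eqP _ _ vv') in wv.
move: vv'; rewrite in_cls => /andP[/vleP vv' _] /vv'[wv'|->]; last by rewrite wv.
by rewrite wv' cls_refl in wv.
Qed.

Lemma L_eq v v' : cls v = cls v' -> L v = L v'.
Proof.
move=> /cls_eqP vv'; apply/setP => w; apply/idP/idP; apply: L_cls => //.
by rewrite cls_sym.
Qed.

Lemma J_eq v v' : cls v = cls v' -> J v = J v'.
Proof. by move=> E; rewrite /J E (L_eq E). Qed.

Lemma L_sym v w : (w \in L v) = (v \in L w).
Proof. by rewrite !in_L cls_sym adj_sym. Qed.

Lemma L_clsr v w w' : w' \in cls w -> w \in L v -> w' \in L v.
Proof. by rewrite L_sym => ww' /(L_cls ww'); rewrite L_sym. Qed.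

Lemma cls_sub_L v w : (cls w \subset L v) = (w \in L v).
Proof.
apply/fintype.subsetP/idP => [|wv w' ww']; first by apply; apply: cls_refl.
exact: L_clsr wv.
Qed.

Lemma in_J v w : (w \in J v) = (w \in L v) || (w \in cls v).
Proof. by rewrite finset.in_setU. Qed.

Lemma L_notin_cls v w : w \in L v -> w \notin cls v.
Proof. by rewrite in_L => /andP[]. Qed.

Lemma L_sub_J v : L v \subset J v.
Proof. exact: finset.subsetUl. Qed.

Lemma cls_sub_J v : cls v \subset J v.
Proof. exact: finset.subsetUr. Qed.

Lemma L_disjoint_cls v : L v :&: cls v = finset.set0.
Proof.
apply/setP => x; rewrite !finset.in_setI finset.in_set0; apply/negP => /andP[/L_notin_cls].
by move=> /negP.
Qed.

Lemma L_adj_cls v w v' w' : w \in L v -> v' \in cls v -> w' \in cls w -> adj v' w'.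
Proof. by move=> wv vv' ww'; apply: L_adj; apply: L_clsr ww' (L_cls vv' wv). Qed.

Lemma st_sub_J v : st v \subset J v.
Proof.
apply/fintype.subsetP => w; rewrite in_st in_J => /orP[/eqP->|vw].
  by rewrite cls_refl orbT.
by rewrite in_L vw andbT; case: (_ \in _).
Qed.

Lemma cls_L_commute v g h : special (cls v) g -> special (L v) h -> commute g h.
Proof.
apply: special_commute => x y xv yv; apply/vgen_commute.
exact: L_adj_cls yv xv (cls_refl y).
Qed.

(** An edge of Gamma pushed up to maximal classes collapses or becomes an edge of Gamma_0. This
    turns paths of Gamma into paths of Gamma_0. *)
Lemma maximal_adjacent v v' x x' : adj x x' -> maximal v -> maximal v' ->
  vle x v -> vle x' v' -> cls v = cls v' \/ v' \in L v.
Proof.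
move=> xx' mv mv' xv xv'; have [vv'|vv'] := boolP (v' \in cls v).
  by left; apply/cls_eqP.
right; rewrite in_L vv' /=; have [x'v|vx'] := vleP _ _ xv x' xx'.
  by rewrite x'v in xv'; rewrite (maximalP mv xv') in vv'.
rewrite adj_sym in vx'; have [vv|] := vleP _ _ xv' v vx'; last by rewrite adj_sym.
by rewrite vv cls_refl in vv'.
Qed.

Definition leaf_like x := exists v, leaf_like_via x v.

Lemma maximal_not_leaf_like x : maximal x -> ~ leaf_like x.
Proof.
move=> mx [v [_ vx _ /andP[xv /eqP]]]; apply.
exact/cls_eqP/(maximalP mx xv).
Qed.

Lemma leaf_like_uniq x v w : leaf_like_via x v -> maximal w -> w \in L x ->
  cls w = cls v.
Proof. by case=> _ _ H _ mw; rewrite -cls_sub_L; apply: H. Qed.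

Hypothesis Gamma_connected : graph_connected Gamma.

(** Connectedness of Gamma_0, as an induction principle. *)
Lemma maximal_ind (Q : Gamma -> Prop) :
  (forall v w, cls v = cls w -> Q v -> Q w) ->
  (forall v w, maximal v -> maximal w -> w \in L v -> Q v -> Q w) ->
  forall v w, maximal v -> maximal w -> Q v -> Q w.
Proof.
move=> Qcls QL v w mv mw Qv.
(* A vertex on the path may lie below several maximal classes, so Q is carried for all of them. *)
have : forall m, maximal m -> vle v m -> Q m.
  by move=> m mm /(maximalP mv)/cls_eqP E; apply: Qcls Qv.
have /connectP[p vp wl] := Gamma_connected v w; clear mv Qv.
elim: p v vp wl => [|y p IH] x /=; first by move=> _ <-; apply=> //; apply: vle_refl.
move=> /andP[xy yp] wl Qx; apply: (IH y) => // m mm ym.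
have [m' mm' xm'] := exists_maximal x.
have [E|mm'm] := maximal_adjacent xy mm' mm xm' ym; first exact: Qcls E (Qx _ _ _).
exact: QL mm'm (Qx _ _ _).
Qed.

Hypothesis Gamma0_ge2 : (2 <= #|Gamma0_vertices Gamma|)%N.

(** Otherwise the induction along Gamma_0 never leaves [v], and Gamma_0 is a single vertex. *)
Lemma maximal_neighbour v : maximal v -> exists2 w, maximal w & w \in L v.
Proof.
move=> mv; apply: contrapT => nw.
have all_v w : maximal w -> cls w = cls v.
  move=> mw; apply: (@maximal_ind (fun m => cls m = cls v) _ _ v w) => //.
  - by move=> m m' ->.
  - move=> m m' mm mm' m'm E; case: nw; exists m' => //.
    by rewrite (L_eq (esym E)).
have : Gamma0_vertices Gamma \subset [set cls v]%SET.
  by apply/fintype.subsetP => X /imsetP[w mw ->]; rewrite finset.in_set1 all_v.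
by move=> /subset_leq_card; rewrite cards1 => /(leq_trans Gamma0_ge2).
Qed.

(** If y is a neighbour of x and m is maximal above y, then x lies in lk(y), hence in st(m). *)
Lemma J_cover x : exists2 v, maximal v & x \in J v.
Proof.
have [m0 mm0 xm0] := exists_maximal x.
have [w mw /L_adj m0w] := maximal_neighbour mm0.
have [y xy] : exists y, adj x y.
  have /connectP[[|y p] /=] := Gamma_connected x w.
    by move=> _ wx; exists m0; rewrite adj_sym -wx.
  by move=> /andP[xy _] _; exists y.
have [m mm ym] := exists_maximal y; exists m => //.
apply: (fintype.subsetP (st_sub_J m)); rewrite in_st.
rewrite adj_sym in xy; have [->|->] := vleP _ _ ym x xy; rewrite ?eqxx ?orbT //.
Qed.

End Classes.

(** * Automorphisms, conjugations and outer classes *)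

Section Automorphisms.
Variable G : groupType.
Implicit Types (f g : Aut G) (H : set G) (a x y : G).

Lemma autM f g x : (f * g) x = f (g x). Proof. by []. Qed.
Lemma aut1 x : (1 : Aut G) x = x. Proof. by []. Qed.
Lemma autVK f x : f^-1 (f x) = x. Proof. exact: aut_funK. Qed.
Lemma autKV f x : f (f^-1 x) = x. Proof. exact: aut_invK. Qed.

Lemma autf1 f : f 1 = 1. Proof. exact: gmulf1. Qed.
Lemma autfV f : {morph f : x / x^-1}. Proof. exact: gmulfV. Qed.
Lemma autfF f : {morph f : x y / x / y}. Proof. exact: gmulfF. Qed.
Lemma autfJ f : {morph f : x y / x ^ y}. Proof. exact: gmulfJ. Qed.

Lemma out_class_mul f g : out_class (f * g) = out_class f * out_class g.
Proof. exact/esym/out_classM. Qed.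

HB.instance Definition _ := isGroupMorphism.Build (Aut G) (Out G) (@out_class G)
  (morph_divg out_class_mul).

Lemma conj_autK a : cancel (fun x : G => x ^ a) (fun x => x ^ a^-1).
Proof. exact: conjgK. Qed.
Lemma conj_autVK a : cancel (fun x : G => x ^ a^-1) (fun x => x ^ a).
Proof. exact: conjgKV. Qed.

Definition conj_aut a : Aut G :=
  MkAut (conj_autK a) (conj_autVK a) (fun x y => conjMg x y a).

Lemma conj_autE a x : conj_aut a x = x ^ a. Proof. by []. Qed.

Lemma out_class_conj a f : out_class (conj_aut a * f) = out_class f.
Proof. by apply/out_classP; exists a. Qed.

Lemma preservesP f H x : preserves f H -> H (f x) <-> H x.
Proof.
move=> fH; split=> [|Hx]; last by rewrite -fH; exists x.
by rewrite -{1}fH => -[y Hy /(can_inj (aut_funK f)) <-].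
Qed.

Lemma preserves_mul f g H : preserves f H -> preserves g H -> preserves (f * g) H.
Proof.
move=> fH gH; apply/seteqP; split=> [_ [x Hx <-]|x Hx].
  by rewrite autM (preservesP _ fH) (preservesP _ gH).
exists (g^-1 (f^-1 x)); last by rewrite autM !autKV.
by rewrite -(preservesP _ gH) -(preservesP _ fH) !autKV.
Qed.

Lemma preserves_inv f H : preserves f H -> preserves f^-1 H.
Proof.
move=> fH; apply/seteqP; split=> [_ [x Hx <-]|x Hx].
  by rewrite -(preservesP _ fH) autKV.
by exists (f x); rewrite ?autVK // (preservesP _ fH).
Qed.

Lemma preserves_fix f H : (forall x, H x -> f x = x) -> preserves f H.
Proof.
move=> fH; apply/seteqP; split=> [_ [x Hx <-]|x Hx]; first by rewrite fH.
by exists x => //; apply: fH.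
Qed.

Lemma preserves_conj a H : is_subgroup H -> H a -> preserves (conj_aut a) H.
Proof.
move=> sH Ha; apply/seteqP; split=> [_ [x Hx <-]|x Hx].
  exact: is_subgroupJ.
exists (x ^ a^-1); last by rewrite conj_autE conjgKV.
by apply: is_subgroupJ => //; apply: is_subgroupV.
Qed.

End Automorphisms.

(** * Representatives preserving a maximal class *)

Section Representatives.
Variable Gamma : sgraph.
Implicit Types (u v w x y z : Gamma) (T : {set Gamma}).
Local Notation A := (raag Gamma).
Implicit Types (f : Aut A) (phi psi : Out A) (g h a b : A).

Lemma aut_raag_eq f f' : (forall v, f (vgen v) = f' (vgen v)) -> f = f'.
Proof. by move=> ff'; apply: aut_eqP; apply: (@raag_hom_eq _ _ (f : {hom _ -> _}) (f' : {hom _ -> _})). Qed.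

Lemma fix_special f T :
  (forall x, x \in T -> f (vgen x) = vgen x) -> forall g, special T g -> f g = g.
Proof.
move=> fT; apply: special_sub => //.
exact: (eq_hom_subgroup (f : {hom _ -> _}) (idfun : {hom _ -> _})).
Qed.

Lemma preserves_special f T :
  (forall x, x \in T -> special T (f (vgen x))) ->
  (forall x, x \in T -> exists2 g, special T g & f g = vgen x) ->
  preserves f (special T).
Proof.
move=> fT Tf; apply/seteqP; split=> [_ [x Tx <-]|].
  apply: (@special_sub _ T [set x | special T (f x)]) Tx => //.
  exact: (preim_subgroup (f : {hom _ -> _}) (special_subgroup T)).
apply: special_sub => [|x /Tf[g Tg <-]]; last by exists g.
apply/is_subgroupP; split; first by exists 1; [exact: special1|exact: gmulf1].
move=> _ _ [x Tx <-] [y Ty <-]; exists (x / y); first exact: specialF.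
exact: gmulfF.
Qed.

Lemma Aut0_subgroup : is_subgroup (Aut0 Gamma).
Proof. exact: generated_subgroup. Qed.

Lemma Aut0_conj a : Aut0 Gamma (conj_aut a).
Proof. by apply: sub_generated; apply: Or41; exists a. Qed.

Lemma Out0_subgroup : is_subgroup (Out0 Gamma).
Proof.
apply/is_subgroupP; split; first by exists 1 => //; exact: is_subgroup1 Aut0_subgroup.
move=> _ _ [f f0 <-] [f' f'0 <-]; exists (f / f'); last exact: gmulfF.
exact: is_subgroupF Aut0_subgroup _ _.
Qed.

Definition has_good_rep v phi := exists f, good_rep v phi f.

Lemma good_repF v phi psi f f' :
  good_rep v phi f -> good_rep v psi f' -> good_rep v (phi / psi) (f / f').
Proof.
move=> [f0 <- fc fJ] [f0' <- fc' fJ']; split.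
- exact: is_subgroupF Aut0_subgroup _ _.
- exact: gmulfF.
- by apply: preserves_mul => //; apply: preserves_inv.
- by apply: preserves_mul => //; apply: preserves_inv.
Qed.

Lemma good_rep1 v : good_rep v 1 1.
Proof. by split=> //; [exact: is_subgroup1 Aut0_subgroup|apply: preserves_fix..]. Qed.

Lemma has_good_rep_subgroup v : is_subgroup [set phi | has_good_rep v phi].
Proof.
apply/is_subgroupP; split=> [|phi psi [f Hf] [f' Hf']]; first by exists 1; apply: good_rep1.
by exists (f / f'); apply: good_repF.
Qed.

Lemma good_rep_conj v phi f a :
  good_rep v phi f -> preserves (conj_aut a) (special (cls v)) ->
  preserves (conj_aut a) (special (J v)) -> good_rep v phi (conj_aut a * f).
Proof.
move=> [f0 <- fc fJ] ac aJ; split; rewrite ?out_class_conj //.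
- exact: is_subgroupM Aut0_subgroup (Aut0_conj _) _.
- exact: preserves_mul.
- exact: preserves_mul.
Qed.

Lemma components_off_stP u (C : {set Gamma}) x :
  C \in components_off_st u -> x \in C -> x \notin st u.
Proof.
move=> /imsetP[c cu ->]; rewrite inE => /connectP[p + ->].
elim: p c cu => [|y p IH] z zu /=; first by rewrite finset.in_setC in zu.
by case/andP => /and3P[_ yu _]; apply: IH; rewrite finset.in_setC.
Qed.

Section Generators.
Variable v : Gamma.
Hypothesis v_max : maximal v.

Lemma inversion_good f T : is_inversion f -> preserves f (special T).
Proof.
move=> [u [fu fnu]]; apply: preserves_special => x xT; have [xu|xu] := eqVneq x u.
- by rewrite xu in xT *; rewrite fu; apply: specialV; apply: special_vgen.
- by rewrite fnu //; apply: special_vgen.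
- exists (vgen x)^-1; first by apply: specialV; apply: special_vgen.
  by rewrite autfV xu fu invgK.
- by exists (vgen x); [exact: special_vgen|exact: fnu].
Qed.

Lemma transvection_good u w f T : is_transvection u w f -> (u \in T -> w \in T) ->
  preserves f (special T).
Proof.
move=> [uw _ fu fnu] uT; have fw : f (vgen w) = vgen w by apply: fnu; rewrite eq_sym.
apply: preserves_special => x xT; have [xu|xu] := eqVneq x u.
- rewrite xu in xT *; rewrite fu.
  by apply: specialM; apply: special_vgen => //; apply: uT.
- by rewrite fnu //; apply: special_vgen.
- have wT : w \in T by apply: uT; rewrite -xu.
  exists (vgen x / vgen w); first by apply: specialF; apply: special_vgen.
  by rewrite autfF fw xu fu mulgK.
- by exists (vgen x); [exact: special_vgen|exact: fnu].
Qed.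

Lemma transvection_cls u w : vle u w -> u \in cls v -> w \in cls v.
Proof.
move=> uw uv; apply: cls_trans (uv) _; apply: maximalP uw; exact: maximal_cls uv v_max.
Qed.

(** The class [v] is closed upwards by maximality; if u is in L_[v], then v lies in lk(u), hence in
    st(w). *)
Lemma transvection_J u w : vle u w -> u \in J v -> w \in J v.
Proof.
move=> uw; rewrite in_J => /orP[uL|uv]; last by rewrite in_J (transvection_cls uw) ?orbT.
have uv : adj u v by rewrite adj_sym L_adj.
have [<-|] := vleP _ _ uw v uv; first by rewrite in_J cls_refl orbT.
by rewrite adj_sym => vw; apply: (fintype.subsetP (st_sub_J v)); rewrite in_st vw orbT.
Qed.

(* If u is not in J_[v], then J_[v] - st(u) lies in one component: otherwise   *)
(* L_[v] would be contained in st(u) and v would not be maximal.               *)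
Lemma J_off_st_connected u x y : u \notin J v -> x \in J v -> y \in J v ->
  x \notin st u -> y \notin st u -> connect (adj_off_st u) x y.
Proof.
move=> uJ xJ yJ xu yu.
have cls_u z : z \in cls v -> z \notin st u.
  move=> zv; apply: contra uJ => zu; rewrite (J_eq (cls_eqP _ _ zv)).
  by apply: (fintype.subsetP (st_sub_J z)); rewrite stC.
have LC l z : l \in L v -> z \in cls v -> l \notin st u ->
    connect (adj_off_st u) l z /\ connect (adj_off_st u) z l.
  move=> lL zv lu; have lz := L_adj_cls lL zv (cls_refl l).
  by split; apply: connect1; rewrite /adj_off_st /= lu cls_u //= 1?adj_sym.
move: xJ yJ; rewrite !in_J => /orP[xL|xv] /orP[yL|yv].
- have [xc _] := LC x v xL (cls_refl v) xu.
  by have [_ cy] := LC y v yL (cls_refl v) yu; apply: connect_trans xc cy.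
- by have [] := LC x y xL yv xu.
- by have [] := LC y x yL xv yu.
have [[l lL lu]|noL] := pselect (exists2 l, l \in L v & l \notin st u).
  have [_ xl] := LC l x lL xv lu; have [ly _] := LC l y lL yv lu.
  exact: connect_trans xl ly.
have [->|nxy] := eqVneq x y; first exact: connect0.
have [xy|xy] := boolP (adj x y); first by apply: connect1; rewrite /adj_off_st /= xu yu.
have xxy : x \in cls y by apply: cls_trans xv; rewrite cls_sym.
(* The equivalent vertices x, y are not adjacent, so no neighbour of x lies in [x]. All of them are
   then in L_[v], which is contained in st(u) here. *)
have xu_le : vle x u.
  apply/vleP => z xz; have : z \in st u.
    apply: contrapT => /negP zu; case: noL; exists z => //.
    apply: (L_cls (v := x)); first by rewrite cls_sym.
    rewrite in_L xz andbT; apply/negP => zx.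
    move: xxy; rewrite in_cls => /andP[_ /vleP/(_ z xz)[zy|yz]].
      by rewrite -zy xz in xy.
    move: zx; rewrite in_cls => /andP[_ /vleP/(_ y)]; rewrite adj_sym => /(_ yz)[yx|xy'].
      by rewrite yx eqxx in nxy.
    by rewrite xy' in xy.
  by rewrite in_st => /orP[/eqP|]; [left|right].
have := transvection_cls xu_le xv; move: uJ; rewrite in_J negb_or => /andP[_ /negPf->//].
Qed.

(** For u in J_[v], f itself works. Otherwise J_[v] - st(u) lies in one component, so f acts on
    A_J[v] trivially or as conjugation by u, which an inner automorphism undoes. *)
Lemma partial_conjugation_good f : is_partial_conjugation f ->
  has_good_rep v (out_class f).
Proof.
move=> fpc; have f0 : Aut0 Gamma f by apply: sub_generated; apply: Or44.
case: fpc => u [C [_ uC fC fnC]]; have Cu x := components_off_stP uC (x := x).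
have /imsetP[c cu defC] := uC.
have fu : f (vgen u) = vgen u by apply: fnC; apply/negP => /Cu; rewrite in_st eqxx.
have fE x : f (vgen x) = vgen x \/ f (vgen x) = vgen x ^ vgen u.
  by have [/fC|/fnC] := boolP (x \in C); [right|left].
have fpres T : u \in T -> preserves f (special T).
  move=> uT; have su := special_vgen uT.
  apply: preserves_special => x xT; have sx := special_vgen xT.
    by case: (fE x) => ->; last exact: specialJ.
  case: (fE x) => fx; first by exists (vgen x).
  exists (vgen x ^ (vgen u)^-1); first by apply: specialJ => //; apply: specialV.
  by rewrite autfJ autfV fu fx conjgK.
have [uJ|uJ] := boolP (u \in J v).
  exists f; split=> //; last exact: fpres.
  move: uJ; rewrite in_J => /orP[uL|]; last exact: fpres.
  apply/preserves_fix/fix_special => x xv; apply: fnC; apply/negP => /Cu/negP; apply.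
  by rewrite in_st adj_sym (L_adj_cls uL xv (cls_refl u)) orbT.
have [[x0 x0J x0C]|noJ] := pselect (exists2 x, x \in J v & x \in C); last first.
  have fJ := @fix_special f (J v).
  exists f; split=> //; apply/preserves_fix => g gJ; apply: fJ.
  - by move=> x xJ; apply: fnC; apply/negP => xC; apply: noJ; exists x.
  - exact: specialS (cls_sub_J v) _ gJ.
  - by move=> x xJ; apply: fnC; apply/negP => xC; apply: noJ; exists x.
  - by [].
have fJ g : special (J v) g -> (conj_aut (vgen u)^-1 * f) g = g.
  apply: fix_special => x xJ; rewrite autM conj_autE.
  have [xC|xC] := boolP (x \in C); first by rewrite fC // conjgK.
  rewrite fnC //; apply/commute_conj/commuteV/vgen_st; rewrite stC.
  apply: contraNT xC => xu; rewrite defC inE.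
  move: (x0C); rewrite {1}defC inE => cx0; apply: connect_trans cx0 _.
  exact: J_off_st_connected (Cu _ x0C) xu.
exists (conj_aut (vgen u)^-1 * f); split; rewrite ?out_class_conj //.
- exact: is_subgroupM Aut0_subgroup (Aut0_conj _) _.
- by apply: preserves_fix => g gv; apply: fJ; apply: specialS (cls_sub_J v) _ gv.
- exact: preserves_fix.
Qed.

Lemma Out0_good_rep phi : Out0 Gamma phi -> has_good_rep v phi.
Proof.
move=> [f f0 <-].
have : (Aut0 Gamma `<=` [set f | has_good_rep v (out_class f)]).
  apply: generated_sub => [|f' gf'].
    exact: (preim_subgroup (@out_class A : {hom _ -> _}) (has_good_rep_subgroup v)).
  have f'0 : Aut0 Gamma f' by apply: sub_generated.
  case: gf' => [[a fa]|inv|[u [w t]]|]; last exact: partial_conjugation_good.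
  - suff -> : f' = conj_aut a * 1 by rewrite /= out_class_conj; exists 1; apply: good_rep1.
    by apply: aut_eqP.
  - by exists f'; split=> //; apply: inversion_good.
  - have uw : vle u w by case: t.
    exists f'; split=> //; apply: transvection_good t _.
      exact: transvection_cls.
    exact: transvection_J.
exact.
Qed.

End Generators.

(** The action on the abelianization is triangular for the order on vertices. The proof carries f
    and its inverse together, so that the condition defines a subgroup. *)
Lemma Aut0_exps f x y : Aut0 Gamma f -> exps y (f (vgen x)) != 0%R -> vle x y.
Proof.
pose tri f := forall x y, exps y (f (vgen x)) != 0%R -> vle x y.
have triM f1 f2 : tri f1 -> tri f2 -> tri (f1 * f2).
  move=> t1 t2 z t; rewrite autM (exps_hom (f1 : {hom _ -> _})) => /eqP.
  apply: contra_notT => /negP zt; apply: big1 => w _.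
  have [->|/t2 zw] := eqVneq (exps w (f2 (vgen z))) 0%R; first by rewrite mul0r.
  have [->|/t1 wt] := eqVneq (exps t (f1 (vgen w))) 0%R; first by rewrite mulr0.
  by case: zt; apply: vle_trans wt.
have triE z t : exps t (vgen z) != 0%R -> vle z t.
  by rewrite exps_vgen; case: (eqVneq z t) => [-> _|_]; [apply: vle_refl|rewrite eqxx].
suff : (Aut0 Gamma `<=` [set f | tri f /\ tri f^-1]) by move=> H /H[/(_ x y)].
apply: generated_sub => [|f'].
  apply/is_subgroupP; split=> [|a b [ta ta'] [tb tb']]; first by rewrite /= invg1.
  by rewrite /= invgM invgK; split; apply: triM.
move=> [[a fa]|[u [fu fnu]]|[u [w [uw uw_le fu fnu]]]|].
- split=> z t; first by rewrite fa expsJ => /triE.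
  suff -> : f'^-1 (vgen z) = vgen z ^ a^-1 by rewrite expsJ => /triE.
  by apply: (can_inj (aut_funK f')); rewrite autKV fa conjgKV.
- suff ff z : f' (vgen z) = vgen z \/ f' (vgen z) = (vgen z)^-1.
    have ff' z : f'^-1 (vgen z) = vgen z \/ f'^-1 (vgen z) = (vgen z)^-1.
      by case: (ff z) => E; [left|right]; apply: (can_inj (aut_funK f'));
        rewrite autKV ?autfV E ?invgK.
    by split=> z t; [case: (ff z)|case: (ff' z)] => ->;
      rewrite ?expsV ?oppr_eq0; apply: triE.
  by have [->|/fnu] := eqVneq z u; [right|left].
- have fw : f' (vgen w) = vgen w by apply: fnu; rewrite eq_sym.
  split=> z t; have [->|zu] := eqVneq z u.
  + rewrite fu expsM => /eqP; apply: contra_notT => ut.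
    have [/eqP-> /eqP->] : exps t (vgen u) == 0%R /\ exps t (vgen w) == 0%R.
      split; apply: contraNT ut => /triE //; exact: vle_trans uw_le.
    by [].
  + by rewrite fnu // => /triE.
  + have -> : f'^-1 (vgen u) = vgen u / vgen w.
      by apply: (can_inj (aut_funK f')); rewrite autKV autfF fu fw mulgK.
    rewrite expsM expsV => /eqP; apply: contra_notT => ut.
    have [/eqP-> /eqP->] : exps t (vgen u) == 0%R /\ exps t (vgen w) == 0%R.
      split; apply: contraNT ut => /triE //; exact: vle_trans uw_le.
    by [].
  + suff -> : f'^-1 (vgen z) = vgen z by exact: triE.
    by apply: (can_inj (aut_funK f')); rewrite autKV fnu.
- case=> u [C [_ uC fC fnC]].
  have fu : f' (vgen u) = vgen u.
    by apply: fnC; apply/negP => /(components_off_stP uC); rewrite in_st eqxx.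
  split=> z t; have [zC|zC] := boolP (z \in C).
  + by rewrite fC // expsJ => /triE.
  + by rewrite fnC // => /triE.
  + suff -> : f'^-1 (vgen z) = vgen z ^ (vgen u)^-1 by rewrite expsJ => /triE.
    by apply: (can_inj (aut_funK f')); rewrite autKV autfJ autfV fu fC // conjgK.
  + suff -> : f'^-1 (vgen z) = vgen z by exact: triE.
    by apply: (can_inj (aut_funK f')); rewrite autKV fnC.
Qed.

End Representatives.

(** * The kernels of P and R *)

Section Kernels.
Variable Gamma : sgraph.
Implicit Types (u v w x y z : Gamma) (T : {set Gamma}).
Local Notation A := (raag Gamma).
Implicit Types (f : Aut A) (phi psi : Out A) (g h a b : A).

Lemma raag_onP T (x : raag_on T) : special T (\val x).
Proof. exact/set_mem/(valP x). Qed.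

Definition to_raag_on T g (gT : special T g) : raag_on T := MkSub (mem_set gT).

Lemma to_raag_onE T g (gT : special T g) : \val (to_raag_on gT) = g.
Proof. by []. Qed.

Lemma raag_on_inj T (x y : raag_on T) : \val x = \val y -> x = y.
Proof. exact: val_inj. Qed.

Lemma raag_on_valJ T (x y : raag_on T) : \val (x ^ y) = \val x ^ \val y.
Proof. by []. Qed.

Section RestrictionAut.
Variables (T : {set Gamma}) (f f' : A -> A).
Hypotheses (fT : forall g, special T g -> special T (f g))
  (f'T : forall g, special T g -> special T (f' g))
  (fK : forall g, special T g -> f' (f g) = g)
  (f'K : forall g, special T g -> f (f' g) = g)
  (fM : forall g h, special T g -> special T h -> f (g * h) = f g * f h).

Let F (x : raag_on T) : raag_on T := to_raag_on (fT (raag_onP x)).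
Let F' (x : raag_on T) : raag_on T := to_raag_on (f'T (raag_onP x)).

(** The hypotheses concern A_T only, so that f may be an automorphism followed by a retraction, as
    the quotient A_J[v] / A_[v] requires. *)
Lemma restrict_aut : exists r : Aut (raag_on T), forall x : raag_on T, \val (r x) = f (\val x).
Proof.
have FK : cancel F F' by move=> x; apply: raag_on_inj; apply: fK; apply: raag_onP.
have F'K : cancel F' F by move=> x; apply: raag_on_inj; apply: f'K; apply: raag_onP.
have FM : {morph F : x y / x * y}.
  by move=> x y; apply: raag_on_inj; apply: fM; apply: raag_onP.
by exists (MkAut FK F'K FM).
Qed.

End RestrictionAut.

(** On A_J[v] the retraction is the projection of the product A_L[v] x A_[v] to its first factor. *)
Lemma special_J_split v g : special (J v) g -> special (cls v) ((retr (L v) g)^-1 * g).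
Proof.
move=> gJ; suff : (special (J v) `&`
    [set g | special (cls v) ((retr (L v) g)^-1 * g)]) g by case.
move: g gJ; apply: special_sub => [|x xJ].
  apply/is_subgroupP; split=> [|a b [aJ ac] [bJ bc]].
    by split; [exact: special1|rewrite /= gmulf1 invg1 mul1g; exact: special1].
  split; first exact: specialF.
  move: ac bc; rewrite /= gmulfF /=; set ra := retr _ a; set rb := retr _ b => ac bc.
  (* The conjugation is by an element of A_L[v], hence trivial on A_[v]. *)
  have -> : (ra / rb)^-1 * (a / b) = ((ra^-1 * a) / (rb^-1 * b)) ^ rb^-1.
    by rewrite conjgE !invgM !invgK !mulgA mulgK.
  rewrite commute_conj; first exact: specialF.
  apply: (@cls_L_commute _ v); first exact: specialF.
  by apply: specialV; apply: retr_special.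
split; first exact: special_vgen.
rewrite /= retr_vgen; case: ifP => xL; first by rewrite mulVg; apply: special1.
rewrite invg1 mul1g; apply: special_vgen.
by move: xJ; rewrite in_J xL.
Qed.

Lemma retr_L_cls v g : special (cls v) g -> retr (L v) g = 1.
Proof. exact/retr_disjoint/L_disjoint_cls. Qed.

Lemma special_cls_J v g : special (cls v) g -> special (J v) g.
Proof. exact: (specialS (cls_sub_J v)). Qed.

Lemma special_L_J v g : special (L v) g -> special (J v) g.
Proof. exact: (specialS (L_sub_J v)). Qed.

Lemma L_coset v g h : special (cls v) (g^-1 * h) -> retr (L v) h = retr (L v) g.
Proof.
by move=> /retr_L_cls; rewrite gmulfM gmulfV /= => /mulg1_eq; rewrite invgK.
Qed.

Section GoodRep.
Variables (v : Gamma) (phi : Out A) (f : Aut A).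
Hypothesis f_good : good_rep v phi f.

(** The retraction changes f(g) by an element of A_[v]; f^-1 sends it into A_[v], which the second
    retraction kills. *)
Lemma good_retr_VK g : special (L v) g -> retr (L v) (f^-1 (retr (L v) (f g))) = g.
Proof.
case: f_good => _ _ fc fJ gL.
have fgJ : special (J v) (f g) by apply/(preservesP _ fJ); exact: special_L_J.
have /(preservesP _ (preserves_inv fc)) := special_J_split fgJ.
rewrite aut_morph autfV autVK => /L_coset <-.
exact: retr_id.
Qed.

End GoodRep.

Lemma good_repV v phi f : good_rep v phi f -> good_rep v phi^-1 f^-1.
Proof. by move=> /(good_repF (good_rep1 v)); rewrite !div1g. Qed.

Lemma P_graph_exists v phi f : good_rep v phi f -> exists rho, @P_graph _ v phi rho.
Proof.
move=> fg; have [f0 _ fc fJ] := fg.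
have [|||||r rE] := @restrict_aut (L v) (fun g => retr (L v) (f g)) (fun g => retr (L v) (f^-1 g)).
- by move=> g _; apply: retr_special.
- by move=> g _; apply: retr_special.
- exact: good_retr_VK fg.
- by move=> g gL; apply: (good_retr_VK (good_repV fg)).
- by move=> g h _ _; rewrite aut_morph gmulfM.
exists (out_class r), f, r; split=> // x; rewrite rE; apply: special_J_split.
apply/(preservesP _ fJ); apply: special_L_J; exact: raag_onP.
Qed.

(** Two representatives differ by conjugation by some a; the retraction of a to A_L[v] conjugates
    the induced automorphisms. *)
Lemma P_graph_uniq v phi : is_subset1 (@P_graph _ v phi).
Proof.
move=> _ _ [f [g [[_ fphi _ _] <- fg]]] [f' [g' [[_ f'phi _ _] <- fg']]].
have /out_classP[a ff'] : out_class f = out_class f' by rewrite fphi.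
apply/out_classP; exists (to_raag_on (@retr_special _ (L v) a)) => x.
apply: raag_on_inj; rewrite raag_on_valJ to_raag_onE.
rewrite -(retr_id (raag_onP (g x))) -(retr_id (raag_onP (g' x))).
by rewrite -(L_coset (fg x)) -(L_coset (fg' x)) ff' gmulfJ.
Qed.

(** If the induced automorphism is conjugation by b in A_L[v], composing f with conjugation by b^-1
    makes it the identity. As b commutes with A_[v], the representative stays good. *)
Lemma P_kernelP v phi : maximal v -> Out0 Gamma phi ->
  P v phi = 1 <-> exists2 f, good_rep v phi f &
    forall x, x \in L v -> special (cls v) ((vgen x)^-1 * f (vgen x)).
Proof.
move=> mv phi0; split=> [Pphi|[f fg fL]]; last first.
  apply: fun_of_rel_uniq; first exact: P_graph_uniq.
  exists f, 1; split=> // x; have [_ _ fc _] := fg.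
  suff : (special (L v) `&` [set g | special (cls v) (g^-1 * f g)]) (\val x) by case.
  have : special (L v) (\val x) by exact: raag_onP.
  apply: special_sub => [|y yL]; last by split; [exact: special_vgen|exact: fL].
  apply/is_subgroupP; split=> [|g h [gL ga] [hL ha]].
    by split; [exact: special1|rewrite /= autf1 mulg1 invg1; exact: special1].
  split; first exact: specialF; rewrite /= autfF.
  have -> : (g / h)^-1 * (f g / f h) = ((g^-1 * f g) / (h^-1 * f h)) ^ h^-1.
    by rewrite conjgE !invgM !invgK !mulgA mulgK.
  rewrite commute_conj; first exact: specialF.
  by apply: (@cls_L_commute _ v); [exact: specialF|exact: specialV].
have [f0 f0g] := Out0_good_rep mv phi0.
have : P_graph phi (P v phi) by apply: fun_of_relP => //; exact: P_graph_exists f0g.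
rewrite Pphi => -[f [g [fg g1 fgL]]].
have [b gb] : exists b : raag_on (L v), forall x : raag_on (L v), g x = x ^ b by apply/(out_classP g 1).
have bL : special (L v) (\val b)^-1 by apply: specialV; exact: raag_onP.
have bc c : special (cls v) c -> c ^ (\val b)^-1 = c.
  by move=> cc; apply: commute_conj; apply: cls_L_commute bL.
exists (conj_aut (\val b)^-1 * f) => [|x xL].
  apply: good_rep_conj fg _ _; first exact: preserves_fix.
  by apply: preserves_conj => //; apply: special_L_J.
pose x' := to_raag_on (special_vgen xL).
have := fgL x'; rewrite gb raag_on_valJ to_raag_onE => H.
rewrite autM conj_autE; suff -> : (vgen x)^-1 * f (vgen x) ^ (\val b)^-1 =
  ((vgen x ^ \val b)^-1 * f (vgen x)) ^ (\val b)^-1 by rewrite bc.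
by rewrite conjMg conjVg conjgK.
Qed.

Lemma R_graph_exists v phi f : good_rep v phi f -> exists rho, @R_graph _ v phi rho.
Proof.
move=> fg; have [f0 _ fc fJ] := fg.
have [|||||r rE] := @restrict_aut (J v) f (f^-1 : Aut A).
- by move=> g /(preservesP _ fJ).
- by move=> g /(preservesP _ (preserves_inv fJ)).
- by move=> g _; apply: autVK.
- by move=> g _; apply: autKV.
- by move=> g h _ _; apply: aut_morph.
by exists (out_class r), f, r.
Qed.

Lemma R_graph_uniq v phi : is_subset1 (@R_graph _ v phi).
Proof.
move=> _ _ [f [g [[_ fphi _ _] <- fg]]] [f' [g' [[_ f'phi _ _] <- fg']]].
have /out_classP[a ff'] : out_class f = out_class f' by rewrite fphi.
apply/out_classP; exists (to_raag_on (@retr_special _ (J v) a)) => x.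
apply: raag_on_inj; rewrite raag_on_valJ to_raag_onE.
rewrite -(retr_id (raag_onP (g x))) -(retr_id (raag_onP (g' x))).
by rewrite fg fg' ff' gmulfJ.
Qed.

Lemma R_kernelP v phi : maximal v -> Out0 Gamma phi ->
  R v phi = 1 <-> exists2 f, good_rep v phi f &
    forall x, x \in J v -> f (vgen x) = vgen x.
Proof.
move=> mv phi0; split=> [Rphi|[f fg fJ]]; last first.
  apply: fun_of_rel_uniq; first exact: R_graph_uniq.
  by exists f, 1; split=> // x; rewrite (fix_special fJ) //; apply: raag_onP.
have [f0 f0g] := Out0_good_rep mv phi0.
have : R_graph phi (R v phi) by apply: fun_of_relP => //; exact: R_graph_exists f0g.
rewrite Rphi => -[f [g [fg g1 fgJ]]].
have [b gb] : exists b : raag_on (J v), forall x : raag_on (J v), g x = x ^ b by apply/(out_classP g 1).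
have fJ x : x \in J v -> (conj_aut (\val b)^-1 * f) (vgen x) = vgen x.
  move=> xJ; rewrite autM conj_autE; have := fgJ (to_raag_on (special_vgen xJ)).
  by rewrite gb raag_on_valJ to_raag_onE => <-; rewrite conjgK.
exists (conj_aut (\val b)^-1 * f) => //; have [f_0 fphi _ _] := fg.
split; rewrite ?out_class_conj //.
- by apply: (is_subgroupM (@Aut0_subgroup _)) => //; apply: Aut0_conj.
- by apply: preserves_fix => h hc; apply: (fix_special fJ); apply: special_cls_J.
- exact/preserves_fix/fix_special.
Qed.

Definition weak_rep v phi f := good_rep v phi f /\
  forall x, x \in L v -> special (cls v) ((vgen x)^-1 * f (vgen x)).

Lemma K_PP phi : K_P Gamma phi <->
  Out0 Gamma phi /\ forall v, maximal v -> exists f, weak_rep v phi f.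
Proof.
split=> -[phi0 H]; split=> // v mv.
  by have [f fg fL] := (P_kernelP mv phi0).1 (H v mv); exists f.
by have [f [fg fL]] := H v mv; apply/P_kernelP => //; exists f.
Qed.

Lemma KP phi : K Gamma phi <-> Out0 Gamma phi /\ forall v, maximal v ->
  exists2 f, good_rep v phi f & forall x, x \in J v -> f (vgen x) = vgen x.
Proof.
by split=> -[phi0 H]; split=> // v mv; apply/R_kernelP => //; apply: H.
Qed.

Lemma K_sub_K_P : K Gamma `<=` K_P Gamma.
Proof.
move=> phi /KP[phi0 H]; apply/K_PP; split=> // v /H[f fg fJ]; exists f; split=> // x xL.
by rewrite fJ ?mulVg; [exact: special1|rewrite in_J xL].
Qed.

Lemma K_P_subgroup : is_subgroup (K_P Gamma).
Proof.
apply/is_subgroupP; split=> [|phi psi /K_PP[phi0 H] /K_PP[psi0 H']]; apply/K_PP.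
  split; first exact: is_subgroup1 (@Out0_subgroup _).
  move=> v _; exists 1; split=> [|x _]; first exact: good_rep1.
  by rewrite aut1 mulVg; exact: special1.
split=> [|v mv]; first exact: is_subgroupF (@Out0_subgroup _) _ _.
have [f [fg fL]] := H v mv; have [f' [f'g f'L]] := H' v mv.
exists (f / f'); split; first exact: good_repF.
move=> x xL; rewrite autM; have [_ _ fc _] := fg; have [_ _ f'c _] := f'g.
have -> : f'^-1 (vgen x) = vgen x / f'^-1 ((vgen x)^-1 * f' (vgen x)).
  by rewrite aut_morph autfV autVK invgM invgK mulVKg.
rewrite autfF mulgA; apply: specialF; first exact: fL.
apply/(preservesP _ fc)/(preservesP _ (preserves_inv f'c)).
exact: f'L.
Qed.

End Kernels.

(** * Invariants of K_P *)

Section Invariants.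
Variable Gamma : sgraph.
Hypothesis Gamma_connected : graph_connected Gamma.
Hypothesis Gamma0_ge2 : (2 <= #|Gamma0_vertices Gamma|)%N.
Implicit Types (u v w x y z : Gamma) (T U : {set Gamma}).
Local Notation A := (raag Gamma).
Implicit Types (f F : Aut A) (phi psi : Out A) (g h a b k : A).

Lemma special_full g : special [set: Gamma]%SET g.
Proof. by apply: (@raag_gen _ (special [set: Gamma]%SET)) => // v; apply: special_vgen; rewrite inE. Qed.

Definition central_in U : {set Gamma} := [set u in U | [forall x in U, u \in st x]]%SET.

Lemma central_inP U u : u \in central_in U -> u \in U /\ forall x, x \in U -> u \in st x.
Proof. by rewrite inE => /andP[uU /forallP H]; split=> // x xU; have := H x; rewrite xU. Qed.

Lemma central_in_clique U : {in central_in U &, forall u x, x \in st u}.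
Proof. by move=> u x /central_inP[uU _] /central_inP[_]; apply. Qed.

(** Each x in U confines g to A_st(x); intersecting these special subgroups one vertex at a time
    gives the claim. *)
Lemma centralizer_special T U g : special T g ->
  (forall x, x \in U -> commute (vgen x) g) ->
  special [set u in T | [forall x in U, u \in st x]]%SET g.
Proof.
move=> gT gU.
have H (s : seq Gamma) : {subset s <= U} -> special [set u in T | all (fun x => u \in st x) s]%SET g.
  elim: s => [_|x s IH sU].
    by apply: specialS gT; apply/fintype.subsetP => u uT; rewrite inE uT.
  have gs := IH (fun y ys => sU y (mem_behead (s := x :: s) ys)).
  have gx := centralizer_vgen (gU x (sU x (mem_head _ _))).
  have := specialI gx gs; apply: specialS; apply/fintype.subsetP => u.
  by rewrite !inE /= => /and3P[ux -> ->]; rewrite !inE ux.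
have /H : {subset enum U <= U} by move=> x; rewrite mem_enum.
apply: specialS; apply/fintype.subsetP => u; rewrite !inE => /andP[-> /allP uU].
by apply/forallP => x; apply/implyP => xU; apply: uU; rewrite mem_enum.
Qed.

Lemma centralizer_central U g : special U g ->
  (forall x, x \in U -> commute (vgen x) g) -> special (central_in U) g.
Proof. exact: centralizer_special. Qed.

Lemma central_commute U g x : special (central_in U) g -> x \in U -> commute (vgen x) g.
Proof.
move=> gU xU; apply: special_commute1 gU => u /central_inP[_ /(_ x xU)].
exact: vgen_st.
Qed.

(** Here f(y) is y times an element of A_[v], but it is also conjugate to F(y), which lies in A_[w].
    Retracting to A_[v] shows that the factor is trivial. *)
Lemma weak_rep_fix_neighbour v w phi f F : w \in L v ->
  weak_rep v phi f -> weak_rep w phi F -> forall y, y \in cls w -> f (vgen y) = vgen y.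
Proof.
move=> wv [[_ fphi _ _] fL] [[_ Fphi Fc _] _] y yw.
have yL : y \in L v := L_clsr yw wv.
have /out_classP[g fF] : out_class f = out_class F by rewrite fphi.
have dis : cls v :&: cls w = finset.set0.
  apply/setP => x; rewrite finset.in_setI finset.in_set0; apply/negP => /andP[xv xw].
  by have := L_notin_cls (L_clsr xw wv); rewrite xv.
have : retr (cls v) (f (vgen y)) = 1.
  rewrite fF gmulfJ /= (retr_disjoint dis) ?conj1g //.
  by apply/(preservesP _ Fc); apply: special_vgen.
rewrite -{1}(mulVKg (vgen y) (f _)) gmulfM /= retr_vgen (negPf (L_notin_cls yL)) mul1g.
by rewrite (retr_id (fL y yL)) => /mulg1_eq <-; rewrite invgK.
Qed.

(* Unlike a weak representative, f fixes A_[v]; its L_[v]-part then lies in    *)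
(* the center of A_[v] and is only nontrivial on leaf-like vertices.           *)
Definition normal_rep v phi f :=
  [/\ out_class f = phi, forall y, y \in cls v -> f (vgen y) = vgen y,
    forall x, x \in L v -> special (cls v) ((vgen x)^-1 * f (vgen x)) &
    forall x, x \in L v -> f (vgen x) = vgen x \/
      leaf_like_via x v /\ exists2 y, y \in cls v & exps y (f (vgen x)) != 0%R].

Lemma exps_out f F x y : out_class f = out_class F ->
  exps y (f (vgen x)) = exps y (F (vgen x)).
Proof. by move=> /out_classP[a ->]; apply: expsJ. Qed.

Lemma exps_weak u phi F x y : weak_rep u phi F -> x \in L u -> y \notin cls u ->
  exps y (F (vgen x)) = exps y (vgen x).
Proof.
move=> [_ FL] xu yu; rewrite -(mulVKg (vgen x) (F _)) expsM.
by rewrite (exps_special yu (FL x xu)) addr0.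
Qed.

(** A weak representative F at a neighbour of [v] fixes A_[v], so f0 acts on A_[v] as a conjugation.
    Its conjugator, retracted to A_[v], corrects f0 without disturbing A_L[v]. *)
Lemma K_P_normal_rep v phi : K_P Gamma phi -> maximal v -> exists f, normal_rep v phi f.
Proof.
move=> /K_PP[phi0 H] mv.
have [f0 f0w] := H v mv; have [w mw wv] := maximal_neighbour Gamma_connected Gamma0_ge2 mv.
have [F Fw] := H w mw; have vw : v \in L w by rewrite L_sym.
have Ffix := weak_rep_fix_neighbour vw Fw f0w.
have [[f00 f0phi f0c f0J] f0L] := f0w; have [[_ Fphi _ _] _] := Fw.
have /out_classP[g Ff] : out_class F = out_class f0 by rewrite f0phi.
pose k := retr (cls v) g; pose f := conj_aut k * f0.
have kc : special (cls v) k := @retr_special _ _ g.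
have fphi : out_class f = phi by rewrite out_class_conj.
have ffix y : y \in cls v -> f (vgen y) = vgen y.
  move=> yv; rewrite /f autM conj_autE.
  have {1}<- : retr (cls v) (f0 (vgen y)) = f0 (vgen y).
    by apply: retr_id; apply/(preservesP _ f0c); apply: special_vgen.
  by rewrite /k -gmulfJ -Ff Ffix //= retr_vgen yv.
have fL x : x \in L v -> special (cls v) ((vgen x)^-1 * f (vgen x)).
  move=> xL; have xk : vgen x ^ k = vgen x.
    by apply/commute_conj/commute_sym; apply: cls_L_commute kc _; apply: special_vgen.
  rewrite /f autM conj_autE -{1}xk -conjVg -conjMg.
  by apply: specialJ => //; apply: f0L.
exists f; split=> // x xL; set a := (vgen x)^-1 * f (vgen x).
have fE : f (vgen x) = vgen x * a by rewrite mulVKg.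
(* As f fixes A_[v], it sends x to an element still commuting with A_[v]; hence so does a. *)
have aZ : special (central_in (cls v)) a.
  apply: centralizer_central; first exact: fL.
  move=> y yv; have xy : commute (vgen y) (vgen x).
    by apply: vgen_commute; apply: L_adj_cls xL yv (cls_refl x).
  apply: commuteM; first exact: commuteV.
  by rewrite -(ffix y yv); apply: (gmulf_commute (f : {hom _ -> _})).
have ax y : y \in cls v -> exps y (f (vgen x)) = exps y a.
  move=> yv; rewrite fE expsM exps_vgen; case: eqP => [xy|_]; last exact: add0r.
  by have := L_notin_cls xL; rewrite xy yv.
have [[y yv ya]|noy] := pselect (exists2 y, y \in cls v & exps y a != 0%R); last first.
  left; rewrite fE (special_clique1 (@central_in_clique _) aZ) ?mulg1 // => u.
  move=> /central_inP[uv _]; apply/eqP; apply: contrapT => /negP ua.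
  by apply: noy; exists u.
right; rewrite -(ax y yv) in ya; split; last by exists y.
have xy : vle x y.
  by apply: Aut0_exps ya; apply: (is_subgroupM (@Aut0_subgroup _)) => //; apply: Aut0_conj.
split=> //.
- by rewrite cls_sub_L L_sym.
(* If [u] differed from [v], the weak representative at u would multiply x by an element of A_[u],
   and the exponent of y would vanish. *)
- move=> u mu; rewrite cls_sub_L => ux; have [yu|yu] := boolP (y \in cls u).
    by rewrite (cls_eqP _ _ yu) -(cls_eqP _ _ yv).
  have [Fu Fuw] := H u mu; have [[_ Fuphi _ _] _] := Fuw.
  rewrite L_sym in ux; have := exps_weak Fuw ux yu.
  rewrite -(exps_out (f := f)) ?fphi // => E; move: ya; rewrite E exps_vgen.
  have nxy : x != y by apply: contraTneq yv => <-; exact: L_notin_cls.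
  by rewrite (negPf nxy) eqxx.
- rewrite /cls_lt; apply/andP; split.
    by apply: vle_trans xy _; move: yv; rewrite in_cls => /andP[].
  by apply/eqP => /cls_eqP; rewrite cls_sym (negPf (L_notin_cls xL)).
Qed.

Lemma leaf_like_via_cls x v w : cls v = cls w -> leaf_like_via x v -> leaf_like_via x w.
Proof.
move=> E [mv vx uniq /andP[xv xnv]].
have wv : w \in cls v by apply/cls_eqP.
split; rewrite -?E //; first exact: maximal_cls wv mv.
rewrite /cls_lt -E xnv andbT; apply: vle_trans xv _.
by move: wv; rewrite in_cls => /andP[].
Qed.

Lemma normal_rep_cls v w phi f : cls v = cls w -> normal_rep v phi f -> normal_rep w phi f.
Proof.
move=> E [fphi fc fL fl]; split; rewrite -?E -?(L_eq E) // => x /fl[->|[xv H]]; first by left.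
by right; split=> //; apply: leaf_like_via_cls xv.
Qed.

Lemma normal_rep_fix v phi f x : normal_rep v phi f -> x \in J v -> ~ leaf_like_via x v ->
  f (vgen x) = vgen x.
Proof.
move=> [_ fc _ fl]; rewrite in_J => /orP[/fl[//|[xv _ nxv]]|/fc//].
by case: nxv.
Qed.

(** Such an x is in a maximal class, or it is joined to the two distinct maximal classes [v] and
    [w]. *)
Lemma overlap_not_leaf_like v w x : maximal v -> maximal w -> w \in L v ->
  x \in J v :&: J w -> ~ leaf_like x.
Proof.
move=> mv mw wv; rewrite finset.in_setI !in_J => /andP[/orP[xv|xv]]; last first.
  by move=> _; apply/maximal_not_leaf_like/(maximal_cls xv).
move=> /orP[xw|xw]; last by apply/maximal_not_leaf_like/(maximal_cls xw).
case=> m xm; have := L_notin_cls wv; move/negP; apply; apply/cls_eqP.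
by rewrite (leaf_like_uniq xm mv) ?(leaf_like_uniq xm mw) // L_sym.
Qed.

Lemma normal_rep_overlap v w phi f : maximal v -> maximal w -> w \in L v ->
  normal_rep v phi f -> forall x, x \in J v :&: J w -> f (vgen x) = vgen x.
Proof.
move=> mv mw wv fv x xvw; apply: (normal_rep_fix fv).
  by move: xvw; rewrite finset.in_setI => /andP[].
by move=> xv; apply: (overlap_not_leaf_like mv mw wv xvw); exists v.
Qed.

(** The conjugator g centralizes the overlap. Since v and w belong to it, g is supported in st(v)
    and st(w), hence in the overlap itself. *)
Lemma overlap_link v w f F : w \in L v -> out_class f = out_class F ->
  (forall x, x \in J v :&: J w -> f (vgen x) = vgen x) ->
  (forall x, x \in J v :&: J w -> F (vgen x) = vgen x) ->
  exists2 g, special (central_in (J v :&: J w)) g & forall b, f b = F b ^ g.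
Proof.
move=> wv /out_classP[g fF] ffix Ffix; exists g => //.
have gJ x : x \in J v :&: J w -> commute (vgen x) g.
  by move=> xvw; apply: conj_commute; rewrite -{1}(Ffix x xvw) -fF ffix.
have := centralizer_special (special_full g) gJ; apply: specialS.
have vU : v \in J v :&: J w by rewrite finset.in_setI !in_J cls_refl L_sym wv orbT.
have wU : w \in J v :&: J w by rewrite finset.in_setI !in_J cls_refl wv orbT.
apply/fintype.subsetP => u; rewrite inE => /andP[_ /forallP H].
have {}H x : x \in J v :&: J w -> u \in st x by move=> xU; have := H x; rewrite xU.
rewrite inE; apply/andP; split; last by apply/forallP => x; apply/implyP; apply: H.
rewrite finset.in_setI (fintype.subsetP (st_sub_J v)) ?(fintype.subsetP (st_sub_J w)) //.
  exact: H.
exact: H.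
Qed.

Definition non_leaf_like : {set Gamma} := [set x | ~~ `[< leaf_like x >]]%SET.

Lemma non_leaf_likeP x : reflect (~ leaf_like x) (x \in non_leaf_like).
Proof. by rewrite inE; apply: (iffP idP) => [/asboolPn|H]; [|apply/asboolPn]. Qed.

(** Each edge of Gamma_0 contributes a conjugator supported in an overlap, where no vertex is
    leaf-like. *)
Lemma normal_reps_conj v f phi w : K_P Gamma phi -> maximal v -> normal_rep v phi f ->
  maximal w -> exists F k, [/\ normal_rep w phi F, special non_leaf_like k &
    forall b, f b = F b ^ k].
Proof.
move=> phiK mv fv mw.
pose Q w := exists F k, [/\ normal_rep w phi F, special non_leaf_like k &
    forall b, f b = F b ^ k].
apply: (@maximal_ind _ Gamma_connected Q _ _ v w) => //.
- move=> {w mw} w w' E [F [k [Fw kN fF]]]; exists F, k; split=> //.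
  exact: normal_rep_cls Fw.
- move=> {w mw} w w' mw mw' w'w [F [k [Fw kN fF]]].
  have [F' F'w'] := K_P_normal_rep phiK mw'.
  have ww' : w \in L w' by rewrite L_sym.
  have [|||g gU FF'] := @overlap_link w w' F F' w'w.
  + by case: Fw F'w' => -> _ _ _ [->].
  + exact: normal_rep_overlap Fw.
  + by rewrite finset.setIC; apply: normal_rep_overlap F'w'.
  exists F', (g * k); split=> [//||x]; last by rewrite fF FF' conjgM.
  apply: specialM => //; move: gU; apply: specialS; apply/fintype.subsetP => u.
  move=> /central_inP[uU _]; apply/non_leaf_likeP.
  exact: overlap_not_leaf_like mw mw' w'w uU.
by exists f, 1; split=> // [|x]; [exact: special1|rewrite conjg1].
Qed.

Lemma normal_rep_form v phi f x : normal_rep v phi f -> x \in J v ->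
  exists a, [/\ f (vgen x) = vgen x * a, special (cls v) a & special (lk x) a].
Proof.
move=> [_ fc fL _]; rewrite in_J => /orP[xL|/fc ->]; last first.
  by exists 1; rewrite mulg1; split=> //; exact: special1.
exists ((vgen x)^-1 * f (vgen x)); rewrite mulVKg; split=> //; first exact: fL.
apply: specialS (fL x xL); apply/fintype.subsetP => y yv; rewrite in_lk adj_sym.
exact: L_adj_cls xL yv (cls_refl x).
Qed.

(** A vertex that is not leaf-like is fixed by the normal representative at any [w] with x in J_[w],
    so f conjugates it. *)
Lemma normal_rep_exps v phi f k u : K_P Gamma phi -> maximal v -> normal_rep v phi f ->
  special non_leaf_like k -> exps u (f k) = exps u k.
Proof.
move=> phiK mv fv; apply: (@special_sub _ _ [set k | exps u (f k) = exps u k]).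
  apply/is_subgroupP; split=> [|a b /= ua ub]; first by rewrite /= autf1.
  by rewrite /= autfF !expsM !expsV ua ub.
move=> x /non_leaf_likeP xN /=; have [w mw xw] := J_cover Gamma_connected Gamma0_ge2 x.
have [F [l [Fw _ ->]]] := normal_reps_conj phiK mv fv mw.
by rewrite expsJ (normal_rep_fix Fw) // => xl; apply: xN; exists w.
Qed.

Lemma exps_mul_lk x y a : special (lk x) a -> y \notin lk x ->
  exps y (vgen x * a) = (x == y)%:R%R.
Proof. by move=> ax yx; rewrite expsM (exps_special yx ax) addr0 exps_vgen. Qed.

(** Neither x nor u occurs in a, so only the exponent 1 of x in x a contributes when conjugating by
    h. *)
Lemma magnus_form x u a h : special (lk x) a -> u \notin st x ->
  magnus x u ((vgen x * a) ^ h) = exps u h.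
Proof.
move=> ax /[dup] ux; rewrite in_st negb_or eq_sym -in_lk => /andP[xu uN].
have xN : x \notin lk x by rewrite in_lk adj_irr.
rewrite magnusJ // magnusM // !exps_mul_lk // eqxx (negPf xu) magnus_vgen.
rewrite (magnus_special xN uN ax) (exps_special uN ax) /=; ring.
Qed.

Definition exps_defect f x y : int := (exps y (f (vgen x)) - (x == y)%:R)%R.

(** Conjugating f by b shifts both terms by the exponent of u in b; the difference depends on the
    outer class only. The value 0 fills the indices where a coefficient has no meaning. *)
Definition magnus_defect f u x z : int :=
  if (u \notin st x) && (u \notin st z)
  then (magnus x u (f (vgen x)) - magnus z u (f (vgen z)))%R else 0%R.

Definition kp_invariant f (i : Gamma * Gamma + Gamma * Gamma * Gamma) : int :=
  match i with
  | inl (x, y) => exps_defect f x y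
  | inr (u, x, z) => magnus_defect f u x z
  end.

Lemma K_P_form v phi f x : K_P Gamma phi -> maximal v -> normal_rep v phi f ->
  exists a k, f (vgen x) = (vgen x * a) ^ k /\ special (lk x) a.
Proof.
move=> phiK mv fv; have [w mw xw] := J_cover Gamma_connected Gamma0_ge2 x.
have [F [k [Fw _ fF]]] := normal_reps_conj phiK mv fv mw.
by have [a [Fx _ ax]] := normal_rep_form Fw xw; exists a, k; rewrite fF Fx.
Qed.

Lemma kp_invariant_out v phi f F i : K_P Gamma phi -> maximal v -> normal_rep v phi f ->
  out_class F = phi -> kp_invariant F i = kp_invariant f i.
Proof.
move=> phiK mv fv Fphi; have [fphi _ _ _] := fv.
have FE := @exps_out F f _ _ (etrans Fphi (esym fphi)).
case: i => [[x y]|[[u x] z]] /=; first by rewrite /exps_defect FE.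
rewrite /magnus_defect; case: ifP => // /andP[ux uz].
have /out_classP[b Fb] : out_class F = out_class f by rewrite fphi.
have FM t : u \notin st t ->
    magnus t u (F (vgen t)) = (magnus t u (f (vgen t)) + exps u b)%R.
  move=> ut; have [a [k [fE ax]]] := K_P_form t phiK mv fv.
  by rewrite Fb fE -conjgM !magnus_form // expsM.
by rewrite !FM //; ring.
Qed.

(** With both classes normalized at the same [w], f' fixes the factor b in A_[w], so f(F(x)) = (x a
    b)^(k f(l)); f preserves the exponents of l. *)
Lemma kp_invariantM v phi psi f F i : K_P Gamma phi -> K_P Gamma psi -> maximal v ->
  normal_rep v phi f -> normal_rep v psi F ->
  kp_invariant (f * F) i = (kp_invariant f i + kp_invariant F i)%R.
Proof.
move=> phiK psiK mv fv Fv.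
have form x : exists a b k l,
    [/\ special (lk x) a /\ special (lk x) b, special non_leaf_like l,
        f (vgen x) = (vgen x * a) ^ k, F (vgen x) = (vgen x * b) ^ l &
        f (F (vgen x)) = (vgen x * (a * b)) ^ (k * f l)].
  have [w mw xw] := J_cover Gamma_connected Gamma0_ge2 x.
  have [f' [k [f'w _ ff']]] := normal_reps_conj phiK mv fv mw.
  have [F' [l [F'w lN FF']]] := normal_reps_conj psiK mv Fv mw.
  have [a [f'x _ ax]] := normal_rep_form f'w xw.
  have [b [F'x bw bx]] := normal_rep_form F'w xw.
  exists a, b, k, l; split; rewrite // ?FF' ?F'x //; first by rewrite ff' f'x.
  have [_ f'c _ _] := f'w.
  by rewrite autfJ conjgM ff' aut_morph f'x (fix_special f'c bw) mulgA.
case: i => [[x y]|[[u x] z]] /=.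
  have [a [b [k [l [[ax bx] lN fx Fx fFx]]]]] := form x.
  by rewrite /exps_defect autM fFx fx Fx !expsJ !expsM exps_vgen; ring.
rewrite /magnus_defect; case: ifP => [/andP[ux uz]|_]; last by rewrite addr0.
have E t : u \notin st t -> magnus t u ((f * F) (vgen t)) =
    (magnus t u (f (vgen t)) + magnus t u (F (vgen t)))%R.
  move=> ut; have [a [b [k [l [[ax bx] lN fx Fx fFx]]]]] := form t.
  rewrite autM fFx fx Fx !magnus_form //; last exact: specialM.
  by rewrite expsM (normal_rep_exps _ phiK mv fv lN).
by rewrite !E //; ring.
Qed.

Lemma normal_rep_exps0 v phi f : normal_rep v phi f ->
  (forall x y, exps_defect f x y = 0%R) -> forall x, x \in J v -> f (vgen x) = vgen x.
Proof.
move=> [_ fc _ fl] f0 x; rewrite in_J => /orP[xL|/fc//].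
have [//|[_ [y yv fxy]]] := fl x xL.
move: fxy; have /eqP := f0 x y; rewrite subr_eq0 => /eqP ->.
have -> : (x == y) = false; last by rewrite eqxx.
by apply: contraNF (L_notin_cls xL) => /eqP ->.
Qed.

Lemma exps_defect_out f F x y : out_class f = out_class F ->
  exps_defect f x y = exps_defect F x y.
Proof. by move=> fF; rewrite /exps_defect (exps_out _ _ fF). Qed.

(** Across an edge of Gamma_0, f acts on A_J[w'] as conjugation by some g from a clique. Vanishing
    Magnus coefficients leave in g only vertices central in J_[w'], so the conjugation is
    trivial. *)
Lemma fix_all_J f phi v : K_P Gamma phi -> maximal v -> out_class f = phi ->
  (forall x, x \in J v -> f (vgen x) = vgen x) ->
  (forall x y, exps_defect f x y = 0%R) ->
  (forall x u, u \notin st x -> magnus x u (f (vgen x)) = 0%R) -> phi = 1.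
Proof.
move=> phiK mv fphi fv f0 fm.
suff f1 : f = 1 by rewrite -fphi f1.
apply: aut_raag_eq => x; have [w mw] := J_cover Gamma_connected Gamma0_ge2 x.
move: x; apply: (@maximal_ind _ Gamma_connected
  (fun w => forall x, x \in J w -> f (vgen x) = vgen x) _ _ v w) => // {w mw} w w'.
  by move=> E Hw x; rewrite -(J_eq E); apply: Hw.
move=> mw mw' w'w Hw.
have [F Fw'] := K_P_normal_rep phiK mw'; have [Fphi _ _ _] := Fw'.
have F0 x y : exps_defect F x y = 0%R.
  by rewrite (@exps_defect_out F f) // Fphi fphi.
have FJ := normal_rep_exps0 Fw' F0.
have [|||g gU fF] := @overlap_link w w' f F w'w.
- by rewrite fphi.
- by move=> x; rewrite finset.in_setI => /andP[xw _]; apply: Hw.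
- by move=> x; rewrite finset.in_setI => /andP[_ xw]; apply: FJ.
pose Z := [set u | [forall x in J w', u \in st x]]%SET.
have gZ : special (central_in (J w :&: J w') :&: Z) g.
  apply: special_clique gU _ => [|u uU ug]; first exact: central_in_clique.
  rewrite inE; apply/forallP => x; apply/implyP => xw'; apply: contraNT ug => ux.
  have := fm x u ux; rewrite fF FJ // -[vgen x]mulg1 magnus_form // => [->//|].
  exact: special1.
move=> x xw'; rewrite fF FJ //; apply: commute_conj; apply: special_commute1 gZ => u.
rewrite finset.in_setI => /andP[_]; rewrite inE => /forallP/(_ x); rewrite xw' /=.
exact: vgen_st.
Qed.

(** Vanishing differences make the Magnus coefficients depend on u only. Conjugating by a central
    element of A_J[v] cancels them without moving A_J[v]. *)
Lemma kp_invariant_inj v phi f : K_P Gamma phi -> maximal v -> normal_rep v phi f ->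
  (forall i, kp_invariant f i = 0%R) -> phi = 1.
Proof.
move=> phiK mv fv f0; have [fphi _ _ _] := fv.
have fe x y : exps_defect f x y = 0%R := f0 (inl (x, y)).
have fJ := normal_rep_exps0 fv fe.
have fm u x z : u \notin st x -> u \notin st z ->
    magnus x u (f (vgen x)) = magnus z u (f (vgen z)).
  move=> ux uz; have := f0 (inr (u, x, z)).
  by rewrite /= /magnus_defect ux uz => /eqP; rewrite subr_eq0 => /eqP.
(* Any x gives the same value; the default 0 concerns vertices u adjacent to all others, for which
   there is no coefficient to cancel. *)
pose c u : int := if [pick x | u \notin st x] is Some x
  then (- magnus x u (f (vgen x)))%R else 0%R.
have cE x u : u \notin st x -> (magnus x u (f (vgen x)) + c u = 0)%R.
  move=> ux; rewrite /c; case: pickP => [z uz|/(_ x)]; last by rewrite ux.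
  by rewrite (fm u x z) // subrr.
have [k kZ kc] := exps_exists (central_in (J v)) c.
pose F := conj_aut k * f.
have Fphi : out_class F = phi by rewrite out_class_conj.
apply: (@fix_all_J F phi v) => //.
- move=> x xv; rewrite autM conj_autE fJ //; apply: commute_conj.
  exact: central_commute kZ xv.
- by move=> x y; rewrite (@exps_defect_out F f) // Fphi fphi.
move=> x u ux; have [a [h [fx ax]]] := K_P_form x phiK mv fv.
rewrite autM conj_autE fx -conjgM magnus_form // expsM -(magnus_form h ax ux) -fx kc.
case: ifP => [_|uN]; first exact: cE.
(* When k cannot contain u, the common coefficient is already 0: it can be computed at a vertex z
   that f fixes. *)
have [z [zv uz]] : exists z, z \in J v /\ u \notin st z.
  have [uJ|uJ] := boolP (u \in J v).
    move: uN; rewrite inE uJ /= => /negbT; rewrite negb_forall => /existsP[z].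
    by rewrite negb_imply => /andP[zv uz]; exists z.
  exists v; rewrite in_J cls_refl orbT; split=> //.
  by apply: contra uJ; apply: (fintype.subsetP (st_sub_J v)).
by rewrite addr0 (fm u x z) // fJ // magnus_vgen.
Qed.

End Invariants.

(** * Leaf transvections *)

Section Transvections.
Variable Gamma : sgraph.
Implicit Types (u v w x y z : Gamma).
Local Notation A := (raag Gamma).

Section Construction.
Variables x y : Gamma.
Hypotheses (xy : x != y) (x_le_y : vle x y).

(** The sign b covers the transvection and its inverse at once. *)
Definition transv_gen (b : bool) v : A := if v == x then vgen x * lgen (y, b) else vgen v.

Lemma transv_gen_commute b v w : adj v w -> commute (transv_gen b v) (transv_gen b w).
Proof.
have xw_comm z : adj x z -> commute (vgen z) (vgen x * lgen (y, b)).
  move=> xz; apply: commuteM; first by apply: vgen_commute; rewrite adj_sym.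
  have zy : commute (vgen z) (vgen y).
    have [->|yz] := vleP _ _ x_le_y z xz; first exact: commute_refl.
    by apply: vgen_commute; rewrite adj_sym.
  by rewrite /lgen; case: b => //=; apply: commuteV.
rewrite /transv_gen => vw; have [vx|vx] := eqVneq v x; have [wx|wx] := eqVneq w x.
- by rewrite vx wx adj_irr in vw.
- by apply/commute_sym/xw_comm; rewrite -vx.
- by apply: xw_comm; rewrite -wx adj_sym.
- exact: vgen_commute.
Qed.

Definition transv_map b : A -> A := raag_lift (transv_gen b).
HB.instance Definition _ b :=
  isGroupMorphism.Build A A (transv_map b) (morph_divg (raag_liftM (@transv_gen_commute b))).

Lemma transv_map_vgen b v : transv_map b (vgen v) = transv_gen b v.
Proof. exact: raag_lift_vgen (@transv_gen_commute b) v. Qed.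

Lemma transv_mapK b : cancel (transv_map b) (transv_map (~~ b)).
Proof.
apply: (@raag_hom_eq _ _ (transv_map (~~ b) \o transv_map b : {hom _ -> _}) (idfun : {hom _ -> _})).
have yx : (y == x) = false by rewrite eq_sym (negPf xy).
move=> v; rewrite /= transv_map_vgen {1}/transv_gen; case: eqP => [->|/eqP vx].
  rewrite gmulfM /= transv_map_vgen {1}/transv_gen eqxx.
  have -> : transv_map (~~ b) (lgen (y, b)) = lgen (y, b).
    by rewrite /lgen /=; case: b; rewrite ?gmulfV /= transv_map_vgen /transv_gen yx.
  by rewrite -lgenV mulgVK.
by rewrite transv_map_vgen /transv_gen (negPf vx).
Qed.

Lemma exists_transvection : exists f, is_transvection x y f.
Proof.
exists (MkAut (@transv_mapK true) (@transv_mapK false) (raag_liftM (@transv_gen_commute true))).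
split=> //= [|u ux]; rewrite transv_map_vgen /transv_gen ?eqxx //.
by rewrite (negPf ux).
Qed.

End Construction.

(** The transvection is its own weak representative at every maximal [u]: if v lies in L_[u],
    uniqueness forces [u] = [w], so the factor w is in A_[u]. *)
Lemma leaf_transvection_K_P v w (f : Aut A) : leaf_like_via v w -> is_transvection v w f ->
  K_P Gamma (out_class f).
Proof.
move=> vw ft; have [_ v_le_w fv fnv] := ft.
have f0 : Aut0 Gamma f by apply: sub_generated; apply: Or43; exists v, w.
apply/K_PP; split; first by exists f.
move=> u mu; exists f; split.
  split=> //; apply: transvection_good ft _; first exact: transvection_cls.
  exact: transvection_J.
move=> x xu; have [xv|xv] := eqVneq x v; last by rewrite fnv // mulVg; apply: special1.
rewrite xv fv mulKg; apply: special_vgen; rewrite xv in xu.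
rewrite (leaf_like_uniq vw mu) ?cls_refl //.
by rewrite L_sym.
Qed.

Lemma transvection_defect v w (f : Aut A) x y : is_transvection v w f ->
  exps_defect f x y = ((x, y) == (v, w))%:R%R.
Proof.
move=> [vw _ fv fnv]; rewrite /exps_defect xpair_eqE.
have [->|xv] := eqVneq x v; last by rewrite fnv // exps_vgen subrr.
by rewrite fv expsM !exps_vgen addrAC subrr add0r /= eq_sym.
Qed.

End Transvections.

(** * Generation by K and leaf transvections *)

Section Generation.
Variable Gamma : sgraph.
Hypothesis Gamma_connected : graph_connected Gamma.
Hypothesis Gamma0_ge2 : (2 <= #|Gamma0_vertices Gamma|)%N.
Implicit Types (u v w x y z : Gamma).
Local Notation A := (raag Gamma).
Implicit Types (f F : Aut A) (phi psi : Out A).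

(** On [K_P] the chosen representative is irrelevant. *)
Definition out_invariant phi i : int := kp_invariant (repr phi) i.

Lemma exists_maximal_vertex : exists v : Gamma, maximal v.
Proof.
have /card_gt0P[X /imsetP[v mv _]] : (0 < #|Gamma0_vertices Gamma|)%N by apply: ltn_trans Gamma0_ge2.
by exists v.
Qed.

Lemma out_invariantE phi f i : K_P Gamma phi -> out_class f = phi ->
  out_invariant phi i = kp_invariant f i.
Proof.
move=> phiK fphi; have [v mv] := exists_maximal_vertex.
have [F Fv] := K_P_normal_rep Gamma_connected Gamma0_ge2 phiK mv.
rewrite /out_invariant (kp_invariant_out _ _ _ phiK mv Fv) ?out_reprK //.
by rewrite (kp_invariant_out _ _ _ phiK mv Fv).
Qed.

Lemma out_invariantM phi psi i : K_P Gamma phi -> K_P Gamma psi ->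
  out_invariant (phi * psi) i = (out_invariant phi i + out_invariant psi i)%R.
Proof.
move=> phiK psiK; have [v mv] := exists_maximal_vertex.
have [f fv] := K_P_normal_rep Gamma_connected Gamma0_ge2 phiK mv.
have [F Fv] := K_P_normal_rep Gamma_connected Gamma0_ge2 psiK mv.
have [[fphi _ _ _] [Fpsi _ _ _]] := (fv, Fv).
rewrite (out_invariantE _ phiK fphi) (out_invariantE _ psiK Fpsi).
rewrite -(kp_invariantM Gamma_connected Gamma0_ge2 _ phiK psiK mv fv Fv).
apply: out_invariantE; first exact: is_subgroupM (@K_P_subgroup _) _ _.
by rewrite out_class_mul fphi Fpsi.
Qed.

Lemma out_invariant1 i : out_invariant 1 i = 0%R.
Proof.
have K1 := is_subgroup1 (@K_P_subgroup Gamma).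
by have /esym/eqP := out_invariantM i K1 K1; rewrite mulg1 -subr_eq0 addrK => /eqP.
Qed.

Lemma out_invariantV phi i : K_P Gamma phi ->
  out_invariant phi^-1 i = (- out_invariant phi i)%R.
Proof.
move=> phiK; have phiVK := is_subgroupV (@K_P_subgroup _) phiK.
have /eqP := out_invariantM i phiK phiVK; rewrite mulgV out_invariant1 eq_sym addrC.
by rewrite addr_eq0 => /eqP.
Qed.

Lemma out_invariantX phi i n : K_P Gamma phi ->
  K_P Gamma (phi ^+ n) /\ out_invariant (phi ^+ n) i = (out_invariant phi i *+ n)%R.
Proof.
move=> phiK; elim: n => [|n [IHK IH]].
  by rewrite out_invariant1; split=> //; apply: is_subgroup1 (@K_P_subgroup _).
rewrite expgS out_invariantM // IH mulrS; split=> //.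
exact: is_subgroupM (@K_P_subgroup _) _ _.
Qed.

Lemma out_invariant_inj phi : K_P Gamma phi -> (forall i, out_invariant phi i = 0%R) -> phi = 1.
Proof.
move=> phiK H; have [v mv] := exists_maximal_vertex.
have [f fv] := K_P_normal_rep Gamma_connected Gamma0_ge2 phiK mv.
apply: (kp_invariant_inj Gamma_connected Gamma0_ge2 phiK mv fv) => i.
by have [fphi _ _ _] := fv; rewrite -(out_invariantE _ phiK fphi).
Qed.

Lemma Aut0_out_class f : Out0 Gamma (out_class f) -> Aut0 Gamma f.
Proof.
move=> [F F0 /esym/out_classP[a fF]].
have -> : f = conj_aut a * F by apply: aut_eqP.
by apply: (is_subgroupM (@Aut0_subgroup _)) => //; apply: Aut0_conj.
Qed.

Lemma K_of_defect phi : K_P Gamma phi ->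
  (forall x y, out_invariant phi (inl (x, y)) = 0%R) -> K Gamma phi.
Proof.
move=> phiK H; have [phi0 _] := phiK; apply/KP; split=> // v mv.
have [f fv] := K_P_normal_rep Gamma_connected Gamma0_ge2 phiK mv.
have [fphi _ _ _] := fv.
have fJ : forall x, x \in J v -> f (vgen x) = vgen x.
  by apply: normal_rep_exps0 fv _ => x y; have := H x y; rewrite (out_invariantE _ phiK fphi).
exists f => //; split=> //; first by apply: Aut0_out_class; rewrite fphi.
  by apply/preserves_fix => g gv; apply: (fix_special fJ); apply: special_cls_J.
exact/preserves_fix/fix_special.
Qed.

(** Guarantees that every nonzero exponent coordinate can be cleared by an available leaf
    transvection. *)
Lemma defect_leaf_like phi x y : K_P Gamma phi -> out_invariant phi (inl (x, y)) != 0%R ->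
  x != y /\ leaf_like_via x y.
Proof.
move=> phiK; have [w mw xw] := J_cover Gamma_connected Gamma0_ge2 x.
have [f fw] := K_P_normal_rep Gamma_connected Gamma0_ge2 phiK mw.
have [fphi fc fL fl] := fw; rewrite (out_invariantE _ phiK fphi) /= /exps_defect.
have [->|nfx] := eqVneq (f (vgen x)) (vgen x); first by rewrite exps_vgen subrr eqxx.
move: xw; rewrite in_J => /orP[xL|/fc E]; last by rewrite E eqxx in nfx.
have [E|[xwl _]] := fl x xL; first by rewrite E eqxx in nfx.
have [yw|yw] := boolP (y \in cls w); last first.
  by rewrite -(mulVKg (vgen x) (f _)) expsM (exps_special yw (fL x xL)) addr0 exps_vgen subrr eqxx.
move=> _; split; first by apply: contraTneq yw => <-; exact: L_notin_cls.
by apply: leaf_like_via_cls xwl; apply/cls_eqP.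
Qed.

(** The list s bounds the support of the exponent coordinates. Leaf transvections are unit vectors
    there, so dividing by a power of one clears a single pair; with none left the class is in
    [K]. *)
Lemma K_P_peel (s : seq (Gamma * Gamma)) phi : K_P Gamma phi ->
  (forall x y, out_invariant phi (inl (x, y)) != 0%R -> (x, y) \in s) ->
  generated (K Gamma `|` leaf_transvections Gamma) phi.
Proof.
elim: s phi => [|[x y] s IH] phi phiK H.
  apply: sub_generated; left; apply: K_of_defect => // x y.
  by apply/eqP; apply: contrapT => /negP /H.
have [xy0|xyn] := eqVneq (out_invariant phi (inl (x, y))) 0%R.
  apply: IH => // z t zt; have := H z t zt; rewrite inE => /orP[/eqP[zx ty]|//].
  by rewrite zx ty xy0 eqxx in zt.
have [xy xyl] := defect_leaf_like phiK xyn.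
have [|t tr] := @exists_transvection _ x y xy.
  by case: xyl => _ _ _ /andP[].
pose T := out_class t.
have TK : K_P Gamma T := leaf_transvection_K_P xyl tr.
have Tg : generated (K Gamma `|` leaf_transvections Gamma) T.
  by apply: sub_generated; right; exists x, y, t.
have TE z u : out_invariant T (inl (z, u)) = ((z, u) == (x, y))%:R%R.
  by rewrite (out_invariantE _ TK (erefl _)) /= (transvection_defect _ _ tr).
have [S [SK Sg SE]] : exists S, [/\ K_P Gamma S,
    generated (K Gamma `|` leaf_transvections Gamma) S &
    forall z u, out_invariant S (inl (z, u)) =
      (out_invariant phi (inl (x, y)) * ((z, u) == (x, y))%:R)%R].
  have TXg n : generated (K Gamma `|` leaf_transvections Gamma) (T ^+ n).
    elim: n => [|n IHn]; first exact: is_subgroup1 (@generated_subgroup _ _).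
    by rewrite expgS; apply: is_subgroupM (@generated_subgroup _ _) _ _.
  case: (out_invariant phi (inl (x, y))) => n.
    exists (T ^+ n); split=> // [|z u]; first by have [] := out_invariantX (inl (x, y)) n TK.
    have [_ ->] := out_invariantX (inl (z, u)) n TK.
    by rewrite TE pmulrn -mulrzr intz mulrC.
  have [TnK _] := out_invariantX (inl (x, y)) n.+1 TK.
  exists (T ^- n.+1); split.
  - exact: is_subgroupV (@K_P_subgroup _) _.
  - exact: is_subgroupV (@generated_subgroup _ _) _.
  - move=> z u; rewrite out_invariantV //.
    have [_ ->] := out_invariantX (inl (z, u)) n.+1 TK.
    by rewrite TE pmulrn -mulrzr intz mulrC NegzE mulNr.
have phiSK : K_P Gamma (phi / S) by apply: is_subgroupF (@K_P_subgroup _) _ _.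
rewrite -(mulgVK S phi); apply: is_subgroupM (@generated_subgroup _ _) _ Sg.
apply: IH => // z u.
rewrite out_invariantM ?out_invariantV //; last exact: is_subgroupV (@K_P_subgroup _) _.
rewrite SE; have [[-> ->]|zu] := eqVneq (z, u) (x, y); first by rewrite mulr1 subrr eqxx.
rewrite mulr0 subr0 => /H; rewrite inE => /orP[/eqP E|//].
by rewrite E eqxx in zu.
Qed.

Lemma K_P_generated : K_P Gamma = generated (K Gamma `|` leaf_transvections Gamma).
Proof.
apply/seteqP; split=> [phi phiK|].
  by apply: (@K_P_peel (enum {: Gamma * Gamma}) phi phiK) => x y _; rewrite mem_enum.
apply: generated_sub; first exact: K_P_subgroup.
move=> phi [/K_sub_K_P //|[v [w [f [vw ft <-]]]]].
exact: leaf_transvection_K_P vw ft.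
Qed.

End Generation.

(** * Subgroups of free abelian groups *)

Section Lattices.
Local Open Scope ring_scope.

(** Induction on n: a basis of the vectors of S with first coordinate 0 is completed by one vector
    whose first coordinate is the least positive one, if any. *)
Lemma lattice_basis n (S : set 'rV[int]_n) : S 0 -> (forall x y, S x -> S y -> S (x - y)) ->
  exists k (B : 'M[int]_(k, n)), (forall x, S x <-> exists c, x = c *m B) /\
    (forall c : 'rV_k, c *m B = 0 -> c = 0).
Proof.
elim: n S => [|n IH] S S0 SB.
  exists 0%N, 0; split=> [x|c _]; last exact: thinmx0.
  by split=> [_|_]; [exists 0; rewrite mulmx0|]; rewrite thinmx0.
have SN x : S x -> S (- x) by move=> Sx; rewrite -sub0r; apply: SB.
have SD x y : S x -> S y -> S (x + y) by move=> Sx Sy; rewrite -[y]opprK; apply/SB/SN.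
have SZ q x : S x -> S (q *: x).
  move=> Sx; have SM m : S (x *+ m) by elim: m => [|m IHm]; rewrite ?mulrS; [|apply: SD].
  by rewrite -[q]intz scaler_int; case: q => m; [|apply: SN]; apply: SM.
pose lift0 (y : 'rV[int]_n) : 'rV[int]_(1 + n) := row_mx 0 y.
have [||k [B [SBP Binj]]] := IH [set y | S (lift0 y)].
- by rewrite /= /lift0 row_mx0.
- move=> y z Sy Sz; suff /= -> : lift0 (y - z) = lift0 y - lift0 z by apply: SB.
  by rewrite /lift0 opp_row_mx add_row_mx subr0.
have split0 (x : 'rV[int]_(1 + n)) : x 0 0 = 0 -> x = lift0 (rsubmx x).
  move=> x0; rewrite -{1}[x]hsubmxK; congr row_mx; apply/rowP => j.
  by rewrite !mxE ord1 -[RHS]x0; congr (x _ _); apply/val_inj.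
have lift0_mul (c : 'rV_k) : lift0 (c *m B) = c *m row_mx 0 B by rewrite mul_mx_row mulmx0.
have lift0_eq0 y : lift0 y = 0 -> y = 0.
  by rewrite /lift0 -[0 in RHS]row_mx0 => /eq_row_mx[].
have [Sz|nSz] := pselect (forall x : 'rV[int]_(1 + n), S x -> x 0 0 = 0).
  exists k, (row_mx 0 B : 'M_(k, 1 + n)); split=> [x|c]; last first.
    by rewrite -lift0_mul => /lift0_eq0/Binj.
  split=> [Sx|[c ->]].
    have [|c E] := (SBP (rsubmx (x : 'rV_(1 + n)))).1.
      by rewrite /= -split0 //; apply: Sz.
    by exists c; rewrite -lift0_mul -E -split0 //; apply: Sz.
  by rewrite -lift0_mul; apply: (SBP _).2; exists c.
(* The shift by one makes the minimum range over positive coordinates only. *)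
pose good m := `[< exists2 x : 'rV[int]_(1 + n), S x & x 0 0 = m.+1%:Z >].
have [m gm] : exists m, good m.
  move/existsNP: nSz => [x /not_implyP[Sx /eqP x0]].
  have Em : (absz (x 0 0)).-1.+1 = absz (x 0 0) by rewrite prednK // absz_gt0.
  exists (absz (x 0 0)).-1; apply/asboolP; have [xpos|xneg] := leP 0 (x 0 0).
    by exists x => //; rewrite Em gez0_abs.
  by exists (- x); [apply: SN|rewrite mxE Em ltz0_abs].
have {m gm}[d /asboolP[b Sb bd] dmin] := ex_minnP (ex_intro _ m gm).
exists (1 + k)%N, (col_mx b (row_mx 0 B) : 'M_(1 + k, 1 + n)); split=> [x|c].
  split=> [Sx|[c ->]]; last first.
    rewrite -[c]hsubmxK mul_row_col -lift0_mul; apply: SD.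
      by rewrite [lsubmx _]mx11_scalar mul_scalar_mx; apply: SZ.
    by apply: (SBP _).2; exists (rsubmx (c : 'rV_(1 + k))).
  pose a : int := x 0 0; pose q := (a %/ d.+1)%Z; pose r := x - q *: (b : 'rV_n.+1).
  have Sr : S r by apply: SB => //; apply: SZ.
  have r0 : r 0 0 = (a %% d.+1)%Z.
    by rewrite !mxE bd -/a {1}(divz_eq a d.+1) /q; ring.
  have r00 : r 0 0 = 0.
    have := modz_ge0 a (isT : d.+1%:Z != 0).
    have := ltz_pmod a (isT : 0 < d.+1%:Z); rewrite -r0.
    case E : (r 0 0) => [[|m]|m] //= md _.
    have /dmin : good m by apply/asboolP; exists r.
    by move: md; rewrite ltz_nat; lia.
  have [|c E] := (SBP (rsubmx (r : 'rV_(1 + n)))).1; first by rewrite /= -split0.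
  exists (row_mx q%:M c : 'rV_(1 + k)); rewrite mul_row_col mul_scalar_mx.
  by rewrite -lift0_mul -E -split0 // /r addrC subrK.
rewrite -[c]hsubmxK mul_row_col -lift0_mul [lsubmx _]mx11_scalar mul_scalar_mx.
set l := lsubmx _ 0 0 => E.
have l0 : l = 0.
  have := congr1 (fun M : 'rV_(1 + n) => M 0 0) E; rewrite !mxE bd.
  case: splitP => // j _; rewrite mxE addr0 => /eqP.
  by rewrite mulf_eq0 orbF => /eqP.
move: E; rewrite l0 scale0r add0r => /lift0_eq0/Binj ->.
by rewrite raddf0 row_mx0.
Qed.

End Lattices.

(** H inherits a basis from its image lattice. The map f chooses preimages; injectivity of psi on H
    makes the choice unique, hence additive. *)
Lemma free_abelian_of_invariants (G : groupType) (H : set G) n (psi : G -> 'rV[int]_n) :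
  is_subgroup H ->
  (forall g h, H g -> H h -> psi (g * h) = (psi g + psi h)%R) ->
  (forall g, H g -> psi g = 0%R -> g = 1) -> free_abelian H.
Proof.
move=> sH psiM psi_inj.
have H1 := is_subgroup1 sH.
have psi1 : psi 1 = 0%R.
  by have /esym/eqP := psiM _ _ H1 H1; rewrite mulg1 -subr_eq0 addrK => /eqP.
have psiF g h : H g -> H h -> psi (g / h) = (psi g - psi h)%R.
  move=> Hg Hh; have HV := is_subgroupV sH Hh; rewrite psiM //; congr (_ + _)%R.
  by apply/eqP; rewrite -addr_eq0 addrC -psiM // mulgV psi1.
have psiI g h : H g -> H h -> psi g = psi h -> g = h.
  move=> Hg Hh E; apply/divg1_eq/psi_inj; first exact: is_subgroupF.
  by rewrite psiF // E subrr.
have [||k [B [SB Binj]]] := @lattice_basis n (psi @` H).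
- by exists 1.
- by move=> _ _ [g Hg <-] [h Hh <-]; exists (g / h); [exact: is_subgroupF|exact: psiF].
pose good (a : {freeg 'I_k / int}) g := H g /\ psi g = ((\row_i coeff i a) *m B)%R.
have [f fP] : {f & forall a, good a (f a)}.
  apply: choice => a.
  by have [g Hg gE] := (SB _).2 (ex_intro _ (\row_i coeff i a)%R (erefl _)); exists g.
exists 'I_k, f; split.
- move=> a b; have [[[Ha Ea] [Hb Eb]] [Hab Eab]] := (fP a, fP b, fP (a + b)%R).
  apply: psiI => //; first exact: is_subgroupM.
  rewrite Eab psiM // Ea Eb -mulmxDl; congr (_ *m _)%R.
  by apply/rowP => i; rewrite !mxE coeffD.
- move=> a b fab; have [_ Ea] := fP a; have [_ Eb] := fP b.
  apply/eqP/freeg_eqP => i.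
  have /Binj/rowP/(_ i) : (((\row_i coeff i a) - (\row_i coeff i b)) *m B = 0)%R.
    by rewrite mulmxBl -Ea -Eb fab subrr.
  by rewrite !mxE => /eqP; rewrite subr_eq0 => /eqP.
- apply/seteqP; split=> [_ [a _ <-]|g Hg]; first by have [] := fP a.
  have [c cE] := (SB (psi g)).1 (ex_intro2 _ _ g Hg erefl).
  pose a : {freeg 'I_k / int} := (\sum_i << c ord0 i *g i >>)%R.
  exists a => //; have [Ha Ea] := fP a; apply: psiI => //; rewrite Ea cE.
  congr (_ *m _)%R; apply/rowP => i; rewrite !mxE /a raddf_sum /= (bigD1 i) //=.
  rewrite coeffU eqxx mulr1 big1 ?addr0 // => j ji.
  by rewrite coeffU (negPf ji) mulr0.
Qed.

Theorem theorem4p2 (Gamma : sgraph) (Gamma_connected : graph_connected Gamma)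
    (Gamma0_ge2 : (2 <= #|Gamma0_vertices Gamma|)%N) :
  free_abelian (K_P Gamma) /\
  K_P Gamma = generated (K Gamma `|` leaf_transvections Gamma).
Proof.
split; last exact: K_P_generated.
(* All exponent and Magnus coordinates together index the ambient Z^N. *)
pose I := (Gamma * Gamma + Gamma * Gamma * Gamma)%type.
apply: (@free_abelian_of_invariants _ _ #|{: I}|
  (fun phi => \row_j out_invariant phi (enum_val j))%R).
- exact: K_P_subgroup.
- by move=> phi psi phiK psiK; apply/rowP => j; rewrite !mxE out_invariantM.
move=> phi phiK E; apply: out_invariant_inj => // i.
by have /rowP/(_ (enum_rank i)) := E; rewrite !mxE enum_rankK.
Qed.
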